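(* Let $E$ be the smooth plane cubic over $\mathbb{C}$ with affine equation $y^2=f(x)$, $f(x)=x^3+ax^2+bx+c$ ($a,b,c\in\mathbb{C}$), with point at infinity $O=[0,1,0]$, and let $\dot{+}$ be the group law on $E$ with zero element $O$. Let $\mathfrak{d}=\sum_{i=1}^d P_i$ ($d\ge 1$) be an effective divisor on $E$ with $P_i\in E\setminus\{O\}$ not necessarily distinct, such that $P_{\mathfrak{d}}:=P_1\dot{+}\cdots\dot{+}P_d=(x_{\mathfrak{d}},y_{\mathfrak{d}})$ is a torsion point of order $n\ge 2$, and assume that $3$ divides $nd$. Let $b_{\mathfrak{d}}=b_0(x)+b_1(x)y\in\mathbb{C}[x,y]$ define a rational function on $E$ with divisor $(b_{\mathfrak{d}})=\mathfrak{d}+\iota^*P_{\mathfrak{d}}-(d+1)O$, let $\xi=\xi_0(x)+\xi_1(x)y\in\mathbb{C}[x,y]$ define a rational function on $E$ with divisor $(\xi)=nP_{\mathfrak{d}}-nO$ (where $b_0,b_1,\xi_0,\xi_1\in\mathbb{C}[x]$), and let $$b_{n\mathfrak{d}}:=\frac{\mathrm{NF}_1(b_{\mathfrak{d}}^n\,\xi)}{(x-x_{\mathfrak{d}})^n}\in\mathbb{C}[x,y],\qquad h_{n\mathfrak{d}}:=\mathrm{NF}_2(b_{n\mathfrak{d}}).$$ Then the plane curve $D_{h_{n\mathfrak{d}}}$ given by $h_{n\mathfrak{d}}=0$ has degree $nd/3$, does not pass through $O$, and satisfies $$D_{h_{n\mathfrak{d}}}|_E=n\sum_{i=1}^d P_i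 .$$ In particular, $D_{h_{n\mathfrak{d}}}$ is an $n$-contact curve to $E$.
   Context: $\iota:E\to E$ is the involution $(x,y)\mapsto(x,-y)$ fixing $O$; for a point $P$, $\iota^*P=\iota(P)$. For a rational function $\varphi$ on $E$, $(\varphi)$ denotes its principal divisor. For $g\in\mathbb{C}[x,y]$: $\mathrm{NF}_1(g)$ is the unique polynomial of the form $r_0(x)+r_1(x)y$, $r_i\in\mathbb{C}[x]$, congruent to $g$ modulo the ideal $\langle y^2-f\rangle$; $\mathrm{NF}_2(g)$ is the unique polynomial of the form $s_0(y)+s_1(y)x+s_2(y)x^2$, $s_i\in\mathbb{C}[y]$, congruent to $g$ modulo $\langle y^2-f\rangle$. (These are the remainders of $g$ on division by $y^2-f$ for the lexicographic orders with $y>x$ and $x>y$, respectively.) In the given setting $\mathrm{NF}_1(b_{\mathfrak{d}}^n\xi)$ is divisible by $(x-x_{\mathfrak{d}})^n$ in $\mathbb{C}[x,y]$, so $b_{n\mathfrak{d}}$ is a polynomial. For a polynomial $g\in\mathbb{C}[x,y]$ of total degree $r\ge 1$, the plane curve $D_g\subset\mathbb{P}^2$ defined by $g=0$ is the degree $r$ curve given by the homogenization $Z^r g(X/Z,Y/Z)=0$. For a plane curve $D$ not containing $E$, $D|_E$ is the divisor on $E$ cut out by $D$ (intersection points counted with intersection multiplicity). A plane curve $D$ is called an $n$-contact curve to $E$ if $D|_E=n\left(\sum_{i=1}^d P_i\right)$ for some points $P_i\in E$ (not necessarily distinct). *)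

(* Defs.v *)
From HB Require Import structures.
From mathcomp Require Import all_boot all_order all_algebra.
From mathcomp Require Import fraction polyXY ring.
From mathcomp Require Import freeg mpoly.

Set Implicit Arguments.
Unset Strict Implicit.
Unset Printing Implicit Defensive.

Import GRing.Theory.
Import Pdiv.Ring Pdiv.RingMonic.

Local Open Scope ring_scope.

(* K[x, y] is {poly {poly K}} with the conventions of polyXY.v: the outer     *)
(* variable 'X is x, the inner variable 'Y = 'X%:P is y, and g.[x0, y0] is    *)
(* evaluation.  A polynomial r(x) is embedded as r^:P, and s(y) as s%:P.      *)

Section LocalIntersection.
Variable K : fieldType.
Implicit Types (p : K * K) (F G g u v : {poly {poly K}}).

Local Notation "g %:F" := (tofrac g).

(* The local ring of the affine plane at p. *)
Definition local_ring p (phi : {fraction {poly {poly K}}}) : Prop :=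
  exists u v, v.[p.1, p.2] != 0 /\ phi = u%:F / v%:F.

Definition local_ideal p F G (phi : {fraction {poly {poly K}}}) : Prop :=
  exists alpha beta, [/\ local_ring p alpha, local_ring p beta
    & phi = alpha * F%:F + beta * G%:F].

(* The K-vector space O_p / (F, G) O_p has dimension m: the classes of some   *)
(* e_0, ..., e_(m-1) form a basis of it.                                      *)
Definition intersection_mult p F G (m : nat) : Prop :=
  exists e : 'I_m -> {fraction {poly {poly K}}},
    (forall i, local_ring p (e i)) /\
    (forall phi, local_ring p phi ->
       exists! k : {ffun 'I_m -> K},
         local_ideal p F G (phi - \sum_(i < m) (k i)%:P%:P%:F * e i)).

(* The class of g in O_p / (F) lies in the k-th power of the maximal ideal.   *)
Definition max_ideal_pow p F (k : nat) g : Prop :=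
  exists (alpha : {fraction {poly {poly K}}})
         (beta : 'I_k.+1 -> {fraction {poly {poly K}}}),
    [/\ local_ring p alpha, (forall i, local_ring p (beta i))
      & g%:F = alpha * F%:F
        + \sum_(i < k.+1)
            beta i * (('X - p.1%:P%:P) ^+ i * ('Y - p.2%:P%:P) ^+ (k - i))%:F].

(* At a smooth point p of F = 0 this is the discrete valuation of O_p / (F);  *)
(* there is no such k when g vanishes identically near p on F = 0.            *)
Definition ord_at p F g (k : nat) : Prop :=
  max_ideal_pow p F k g /\ ~ max_ideal_pow p F k.+1 g.

End LocalIntersection.

Section PlaneCurves.
Variable K : fieldType.
Implicit Types (g : {poly {poly K}}) (G : {mpoly K[3]}).

Definition iX : 'I_3 := @Ordinal 3 0 isT.
Definition iY : 'I_3 := @Ordinal 3 1 isT.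
Definition iZ : 'I_3 := @Ordinal 3 2 isT.

(* A plane curve of degree r, as a form in X, Y, Z. *)
Definition plane_curve (r : nat) G : Prop :=
  [/\ (0 < r)%N, G != 0 & G \is r.-homog].

Definition smooth_curve G : Prop :=
  forall v : 'I_3 -> K, (exists i, v i != 0) -> G.@[v] = 0 ->
    exists i, (G^`M(i)).@[v] != 0.

Definition total_degree g : nat :=
  (\max_(i < size g | (g`_i != 0)%R) (i + (size (g`_i)%R).-1))%N.

(* Z^r g(X/Z, Y/Z), where r is the total degree of g; for r >= 1 this is the  *)
(* curve D_g.                                                                 *)
Definition homogenize g : {mpoly K[3]} :=
  \sum_(i < size g) \sum_(j < size g`_i)
    g`_i`_j *: ('X_iX ^+ i * 'X_iY ^+ j * 'X_iZ ^+ (total_degree g - (i + j))).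

Definition mpoly_subst (s : 3.-tuple {poly {poly K}}) G : {poly {poly K}} :=
  mmap (fun k => k%:P%:P) (tnth s) G.

End PlaneCurves.

Section WeierstrassCubic.
Variables (K : fieldType) (a b c : K).
Implicit Types (g h : {poly {poly K}}) (G : {mpoly K[3]}).

Definition cubic_poly : {poly K} := 'X^3 + a *: 'X^2 + b *: 'X + c%:P.

Definition cubic_form : {mpoly K[3]} :=
  'X_iY ^+ 2 * 'X_iZ
  - ('X_iX ^+ 3 + a *: ('X_iX ^+ 2 * 'X_iZ) + b *: ('X_iX * 'X_iZ ^+ 2)
     + c *: 'X_iZ ^+ 3).

(* Some (x, y) is the affine point [x, y, 1], None is O = [0, 1, 0], the only *)
(* point of the cubic on the line Z = 0.                                      *)
Definition on_cubic (P : option (K * K)) : bool :=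
  if P is Some (x, y) then y ^+ 2 == cubic_poly.[x] else true.

Record cubic_pt := CubicPt {pt_val :> option (K * K); _ : on_cubic pt_val}.
HB.instance Definition _ := [isSub for pt_val].
HB.instance Definition _ := [Choice of cubic_pt by <:].

Implicit Types P Q : cubic_pt.

Definition O_pt : cubic_pt := @CubicPt None isT.

Definition raw_opp (P : option (K * K)) : option (K * K) :=
  if P is Some (x, y) then Some (x, - y) else None.

Lemma on_cubic_opp P : on_cubic (raw_opp P).
Proof. by case: P => -[[x y]|] //=; rewrite sqrrN. Qed.

Definition iota_pt P : cubic_pt := CubicPt (on_cubic_opp P).

Definition chord_third (l x1 y1 x2 : K) : option (K * K) :=
  let x3 := l ^+ 2 - a - x1 - x2 in Some (x3, - (y1 + l * (x3 - x1))).

(* Chord-tangent addition. *)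
Definition raw_add (P Q : option (K * K)) : option (K * K) :=
  match P, Q with
  | None, _ => Q
  | _, None => P
  | Some (x1, y1), Some (x2, y2) =>
      if x1 != x2 then chord_third ((y2 - y1) / (x2 - x1)) x1 y1 x2
      else if y1 == - y2 then None
      else chord_third ((3 * x1 ^+ 2 + 2 * a * x1 + b) / (2 * y1)) x1 y1 x2
  end.

Lemma on_cubic_add P Q : on_cubic (raw_add P Q).
Proof.
have fE x : cubic_poly.[x] = x ^+ 3 + a * x ^+ 2 + b * x + c.
  by rewrite /cubic_poly !hornerE.
case: P Q => -[[x1 y1]|] // e1 [[[x2 y2]|] // e2] /=.
move: e1 e2; rewrite /= !fE => /eqP e1 /eqP e2.
case: eqVneq => [ex|nx] /=; last first.
  rewrite fE; apply/eqP.
  have nx0 : x2 - x1 != 0 by rewrite subr_eq0 eq_sym.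
  have cE : c = y1 ^+ 2 - (x1 ^+ 3 + a * x1 ^+ 2 + b * x1) by rewrite e1; ring.
  have bE : b = ((y2 ^+ 2 - y1 ^+ 2) - (x2 ^+ 3 - x1 ^+ 3)
                 - a * (x2 ^+ 2 - x1 ^+ 2)) / (x2 - x1).
    by apply: (mulIf nx0); rewrite divfK // e1 e2; ring.
  by rewrite cE bE; field.
case: eqVneq => //= ny; rewrite fE; apply/eqP.
have ey : y1 = y2.
  have : (y1 - y2) * (y1 + y2) == 0.
    by apply/eqP; transitivity (y1 ^+ 2 - y2 ^+ 2); [ring|rewrite e1 e2 ex; ring].
  by rewrite mulf_eq0 subr_eq0 addr_eq0 (negPf ny) orbF => /eqP.
have n2y : 2 * y1 != 0.
  have -> : 2 * y1 = y1 + y2 by rewrite -ey; ring.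
  by rewrite addr_eq0.
move: (n2y); rewrite mulf_eq0 negb_or => /andP[n2 ny1].
have cE : c = y1 ^+ 2 - (x1 ^+ 3 + a * x1 ^+ 2 + b * x1) by rewrite e1; ring.
by rewrite cE -ex; field; rewrite ny1 n2.
Qed.

Definition add_pt P Q : cubic_pt := CubicPt (on_cubic_add P Q).

Definition mul_pt (m : nat) P : cubic_pt := iter m (add_pt P) O_pt.

Definition has_order (n : nat) P : Prop :=
  [/\ (0 < n)%N, mul_pt n P = O_pt
    & forall m, (0 < m < n)%N -> mul_pt m P <> O_pt].

(* Affine chart of the projective plane around P: Z = 1 with coordinates      *)
(* (x, y) = (X/Z, Y/Z) at an affine point, Y = 1 with coordinates             *)
(* (X/Y, Z/Y) at O.                                                           *)
Definition chart P G : {poly {poly K}} :=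
  mpoly_subst (if pt_val P is Some _ then [tuple 'X; 'Y; 1]
               else [tuple 'X; 1; 'Y]) G.

Definition chart_pt P : K * K := if pt_val P is Some p then p else (0, 0).

(* The divisor D cut out on the cubic by the form G; it does not exist when   *)
(* the curve G contains the cubic.                                            *)
Definition restricts_to G (D : {freeg cubic_pt}) : Prop :=
  forall P, exists m : nat,
    intersection_mult (chart_pt P) (chart P cubic_form) (chart P G) m
    /\ coeff P D = m%:Z.

(* g defines the rational function G / Z^r on the cubic, where G is the       *)
(* homogenization of g and r its total degree.                                *)
Definition principal_divisor g (D : {freeg cubic_pt}) : Prop :=
  forall P, exists k l : nat,
    [/\ ord_at (chart_pt P) (chart P cubic_form) (chart P (homogenize g)) k,
        ord_at (chart_pt P) (chart P cubic_form)
               (chart P ('X_iZ ^+ total_degree g)) l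
      & coeff P D = k%:Z - l%:Z].

Definition n_contact (n : nat) G : Prop :=
  (exists r, plane_curve r G) /\
  exists (d : nat) (P : 'I_d -> cubic_pt),
    restricts_to G ((\sum_(i < d) << P i >>) *+ n).

Definition weierstrass : {poly {poly K}} := 'Y ^+ 2 - cubic_poly^:P.

(* Remainder on division by y^2 - f, as a polynomial in y. *)
Definition NF1 g : {poly {poly K}} :=
  swapXY (rmodp (swapXY g) (swapXY weierstrass)).

(* Remainder on division by y^2 - f, as a polynomial in x; the sign makes the *)
(* divisor monic.                                                             *)
Definition NF2 g : {poly {poly K}} := rmodp g (- weierstrass).

Lemma swapXY_weierstrass : swapXY weierstrass = 'X^2 - cubic_poly%:P.
Proof. by rewrite rmorphB rmorphXn /= swapXY_Y swapXY_map_polyC. Qed.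

Lemma size_swap_weierstrass : size (swapXY weierstrass) = 3%N.
Proof.
rewrite swapXY_weierstrass size_polyDl ?size_polyXn //.
by rewrite size_polyN (leq_ltn_trans (size_polyC_leq1 _)).
Qed.

Lemma monic_swap_weierstrass : swapXY weierstrass \is monic.
Proof.
rewrite swapXY_weierstrass monicE lead_coefDl ?lead_coefXn ?size_polyXn //.
by rewrite size_polyN (leq_ltn_trans (size_polyC_leq1 _)).
Qed.

Lemma oppr_weierstrass :
  - weierstrass = 'X^3 + (a%:P *: 'X^2 + b%:P *: 'X + (c%:P - 'X^2)%:P).
Proof.
rewrite /weierstrass /cubic_poly !rmorphD /= !map_polyZ /= !map_polyXn map_polyX.
by rewrite map_polyC /= rmorphN rmorphXn /=; ring.
Qed.

Lemma size_weierstrass_tail :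
  (size (a%:P *: 'X^2 + b%:P *: 'X + (c%:P - 'X^2)%:P : {poly {poly K}})%R <= 3)%N.
Proof.
rewrite (leq_trans (size_polyD _ _)) // geq_max; apply/andP; split; last first.
  by rewrite (leq_trans (size_polyC_leq1 _)).
rewrite (leq_trans (size_polyD _ _)) // geq_max.
by rewrite !(leq_trans (size_scale_leq _ _)) ?size_polyXn ?size_polyX.
Qed.

Lemma size_opp_weierstrass : size (- weierstrass) = 4%N.
Proof.
by rewrite oppr_weierstrass size_polyDl size_polyXn // ltnS size_weierstrass_tail.
Qed.

Lemma monic_opp_weierstrass : - weierstrass \is monic.
Proof.
rewrite oppr_weierstrass monicE lead_coefDl ?lead_coefXn //.
by rewrite size_polyXn ltnS size_weierstrass_tail.
Qed.

Lemma NF1P g r0 r1 :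
  (exists q, g = q * weierstrass + (r0^:P + r1^:P * 'Y)) <->
  NF1 g = r0^:P + r1^:P * 'Y.
Proof.
have sr : swapXY (r0^:P + r1^:P * 'Y) = r0%:P + r1%:P * 'X.
  by rewrite rmorphD rmorphM /= !swapXY_map_polyC swapXY_Y.
split=> [[q gE]|E]; last first.
  exists (swapXY (rdivp (swapXY g) (swapXY weierstrass))).
  rewrite -E -[LHS]swapXYK [in LHS](rdivp_eq monic_swap_weierstrass (swapXY g)).
  by rewrite rmorphD rmorphM /= swapXYK.
apply: (can_inj (@swapXYK _)); rewrite /NF1 swapXYK gE rmorphD rmorphM /= sr.
rewrite rmodp_addl_mul_small ?monic_swap_weierstrass //.
rewrite size_swap_weierstrass ltnS (leq_trans (size_polyD _ _)) // geq_max.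
rewrite (leq_trans (size_polyC_leq1 _)) //= mul_polyC.
by rewrite (leq_trans (size_scale_leq _ _)) // size_polyX.
Qed.

Lemma NF1_form g : exists r0 r1, NF1 g = r0^:P + r1^:P * 'Y.
Proof.
set r := rmodp (swapXY g) (swapXY weierstrass).
have sz : (size r <= 2)%N.
  rewrite -ltnS -size_swap_weierstrass ltn_rmodp.
  by rewrite -size_poly_eq0 size_swap_weierstrass.
exists r`_0, r`_1; rewrite /NF1 -/r; apply: (can_inj (@swapXYK _)).
rewrite swapXYK rmorphD rmorphM /= !swapXY_map_polyC swapXY_Y.
apply/polyP => -[|[|i]]; rewrite coefD coefC coefMX ?coefC /= ?addr0 ?add0r //.
by rewrite nth_default // (leq_trans sz).
Qed.

Lemma NF2P g (s0 s1 s2 : {poly K}) :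
  (exists q, g = q * weierstrass + (s0%:P + s1%:P * 'X + s2%:P * 'X^2)) <->
  NF2 g = s0%:P + s1%:P * 'X + s2%:P * 'X^2.
Proof.
split=> [[q ->]|E]; last first.
  exists (- rdivp g (- weierstrass)).
  by rewrite -E mulNr -mulrN -(rdivp_eq monic_opp_weierstrass).
rewrite /NF2 -[q * _]mulrNN rmodp_addl_mul_small ?monic_opp_weierstrass //.
rewrite size_opp_weierstrass ltnS !mul_polyC.
rewrite (leq_trans (size_polyD _ _)) // geq_max; apply/andP; split; last first.
  by rewrite (leq_trans (size_scale_leq _ _)) // size_polyXn.
rewrite (leq_trans (size_polyD _ _)) // geq_max.
rewrite (leq_trans (size_polyC_leq1 _)) //=.
by rewrite (leq_trans (size_scale_leq _ _)) // size_polyX.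
Qed.

Lemma NF2_form g :
  exists s0 s1 s2 : {poly K}, NF2 g = s0%:P + s1%:P * 'X + s2%:P * 'X^2.
Proof.
set r := NF2 g; have sz : (size r <= 3)%N.
  rewrite -ltnS -size_opp_weierstrass ltn_rmodp.
  by rewrite -size_poly_eq0 size_opp_weierstrass.
exists r`_0, r`_1, r`_2; apply/polyP => i.
rewrite !coefD coefC coefMX coefMXn coefC coefC.
case: i => [|[|[|i]]] /=; rewrite ?addr0 ?add0r //.
by rewrite nth_default // (leq_trans sz).
Qed.

End WeierstrassCubic.

(* Main.v *)
Require Import Defs.
From mathcomp Require Import all_boot all_order all_algebra.
From mathcomp Require Import fraction polyXY ring zify.
From mathcomp Require Import reals complex.
From mathcomp Require Import freeg mpoly.

Set Implicit Arguments.
Unset Strict Implicit.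
Unset Printing Implicit Defensive.

Import GRing.Theory.
Import Pdiv.Ring Pdiv.RingMonic.

Local Open Scope ring_scope.

(** At a smooth point p of a curve F = 0 one of the two coordinates, t, is a
    uniformizer, and order k at p means v g = u t^k + w F with u, v nonzero at
    p.  Orders of polynomials are read off from the given divisors, are additive
    on products, and determine the intersection numbers, since 1, t, ..., t^(k-1)
    is a basis of O_p / (F, t^k).  The affine part of the divisor of b_nd is thus
    n times that of d; in particular b_d^n xi vanishes to order n at both points
    above x_d, and (x - x_d)^n can be divided out in C[x] + C[x] y.

    At O the order of g is governed by its weight 2 deg_x + 3 deg_y, which for
    r0 + r1 y is the degree of the norm r0^2 - f r1^2.  By multiplicativity of
    the norm b_nd has weight nd.  As y^2 and f have the same weight 6, neither
    normal form increases the weight, so h has weight exactly nd as well.  The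
    weights in s0(y) + s1(y) x + s2(y) x^2 are distinct modulo 3 and 3 | nd, so
    the leading monomial is y^(nd/3): this gives the degree of h and shows that
    its curve avoids O. *)

(** * Orders in the local ring of a plane curve *)

Section LocalRing.
Variable K : fieldType.
Implicit Types (p : K * K) (F G g s t u v w : {poly {poly K}}).
Implicit Types (phi psi : {fraction {poly {poly K}}}).

Local Notation "g %:F" := (tofrac g).

Lemma ev_neq0 p v : v.[p.1, p.2] != 0 -> v%:F != 0.
Proof. by apply: contraNneq => /eqP; rewrite tofrac_eq0 => /eqP->; rewrite !horner0. Qed.

Lemma evM p u v : (u * v).[p.1, p.2] = u.[p.1, p.2] * v.[p.1, p.2].
Proof. by rewrite !hornerM. Qed.

Lemma evD p u v : (u + v).[p.1, p.2] = u.[p.1, p.2] + v.[p.1, p.2].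
Proof. by rewrite !hornerD. Qed.

Lemma evN p u : (- u).[p.1, p.2] = - u.[p.1, p.2].
Proof. by rewrite !hornerN. Qed.

Lemma evXn p u k : (u ^+ k).[p.1, p.2] = u.[p.1, p.2] ^+ k.
Proof. by rewrite !horner_exp. Qed.

Lemma evC p x : (x%:P%:P : {poly {poly K}}).[p.1, p.2] = x.
Proof. by rewrite !hornerC. Qed.

Lemma local_ring_poly p u : local_ring p u%:F.
Proof. by exists u, 1; rewrite !hornerC oner_neq0 tofrac1 divr1. Qed.

Lemma local_ringD p phi psi :
  local_ring p phi -> local_ring p psi -> local_ring p (phi + psi).
Proof.
move=> [u [v [nv ->]]] [u' [v' [nv' ->]]].
exists (u * v' + u' * v), (v * v'); rewrite evM mulf_neq0 //; split=> //.
rewrite tofracD !tofracM; exact: addf_div (ev_neq0 nv) (ev_neq0 nv').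
Qed.

Lemma local_ringM p phi psi :
  local_ring p phi -> local_ring p psi -> local_ring p (phi * psi).
Proof.
move=> [u [v [nv ->]]] [u' [v' [nv' ->]]].
exists (u * u'), (v * v'); rewrite evM mulf_neq0 //; split=> //.
rewrite !tofracM; exact: mulf_div.
Qed.

Lemma local_idealD p F G phi psi :
  local_ideal p F G phi -> local_ideal p F G psi -> local_ideal p F G (phi + psi).
Proof.
move=> [x [y [lx ly ->]]] [x' [y' [lx' ly' ->]]].
exists (x + x'), (y + y'); split; try exact: local_ringD.
rewrite !mulrDl; exact: addrACA.
Qed.

Lemma local_idealMl p F G phi psi :
  local_ring p phi -> local_ideal p F G psi -> local_ideal p F G (phi * psi).
Proof.
move=> lp [x [y [lx ly ->]]].
exists (phi * x), (phi * y); split; try exact: local_ringM.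
by rewrite mulrDr -!mulrA.
Qed.

(* Over an abstract field, as are the next two, because conversion in
   [{fraction _}] blows up. *)
Lemma clear_denominators (L : fieldType) (v v' x y f g : L) :
  v != 0 -> v' != 0 ->
  v * v' * (x / v * f + y / v' * g) = x * v' * f + y * v * g.
Proof. by move=> nv nv'; field; rewrite nv nv'. Qed.

Lemma local_ideal_mulE (L : fieldType) (x1 x2 y1 y2 f a b : L) :
  (x1 * f + x2 * a) * (y1 * f + y2 * b) =
  (x1 * (y1 * f + y2 * b) + x2 * a * y1) * f + x2 * y2 * (a * b).
Proof. by ring. Qed.

Lemma mul_frac_sub (L : fieldType) (x y s : L) :
  y != 0 -> x - y * s = y * (x / y - s).
Proof. by move=> ny; field. Qed.

(** Clearing denominators turns membership in the local ideal into a polynomial identity, with [v] a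
    unit at [p]; the later arguments then stay among polynomials. *)
Lemma local_ideal_poly p F G s :
  local_ideal p F G s%:F <->
  exists v x y, v.[p.1, p.2] != 0 /\ v * s = x * F + y * G.
Proof.
split=> [[_ [_ [[x [v [nv ->]]] [y [v' [nv' ->]]] E]]]|[v [x [y [nv E]]]]].
  exists (v * v'), (x * v'), (y * v); rewrite evM mulf_neq0 //; split=> //.
  apply/eqP; rewrite -tofrac_eq; apply/eqP.
  rewrite !(tofracM, tofracD) E.
  exact: clear_denominators (ev_neq0 nv) (ev_neq0 nv').
exists (x%:F / v%:F), (y%:F / v%:F); split; [by exists x, v|by exists y, v|].
apply: (mulfI (mulf_neq0 (ev_neq0 nv) (ev_neq0 nv))).
rewrite (clear_denominators _ _ _ _ (ev_neq0 nv) (ev_neq0 nv)).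
rewrite -!tofracM -tofracD; congr (_%:F).
by rewrite -mulrA E; ring.
Qed.

(** The restriction of [g] to the line x = [p.1] is divisible by y - [p.2], and [g] minus that
    restriction by x - [p.1]. *)
Lemma eval0_split p g : g.[p.1, p.2] = 0 ->
  exists s s', g = s * ('X - p.1%:P%:P) + s' * ('Y - p.2%:P%:P).
Proof.
move=> g0; have /factor_theorem[s'] : root g.[p.1%:P] p.2 by exact/eqP.
have /factor_theorem[s] : root (g - g.[p.1%:P]%:P) p.1%:P.
  by rewrite /root hornerD hornerN hornerC subrr.
move=> /eqP; rewrite subr_eq => /eqP gE s'E.
by exists s, s'%:P; rewrite {1}gE s'E rmorphM rmorphB.
Qed.

(** The flag is true for y and false for x; in [local_param] the value at [bx] is the coordinate
    different from [t]. *)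
Definition other_coord p (bx : bool) : {poly {poly K}} :=
  if bx then 'Y - p.2%:P%:P else 'X - p.1%:P%:P.

(* [t], one of the two coordinates at [p], generates the maximal ideal of
   O_p / (F) and is a nonzerodivisor modulo [F]. *)
Definition local_param p F t : Prop :=
  [/\ F.[p.1, p.2] = 0, t.[p.1, p.2] = 0, t != 0,
     (forall s q, t * s = q * F -> exists q', q = t * q')
   & exists bx v s w, [/\ t = other_coord p (~~ bx),
       v.[p.1, p.2] != 0 & v * other_coord p bx = s * t + w * F]].

(* With denominators cleared: [g] is a unit times [t ^+ k] in O_p / (F). *)
Definition val_at p F t g (k : nat) : Prop :=
  exists u v w,
    [/\ u.[p.1, p.2] != 0, v.[p.1, p.2] != 0 & v * g = u * t ^+ k + w * F].

Section Param.
Variables (p : K * K) (F t : {poly {poly K}}).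
Hypothesis tP : local_param p F t.

Lemma max_ideal_gen g : g.[p.1, p.2] = 0 ->
  exists v s w, v.[p.1, p.2] != 0 /\ v * g = s * t + w * F.
Proof.
have [_ _ _ _ [bx [v [s [w [tE nv vE]]]]]] := tP.
move=> /eval0_split[x [y ->]]; exists v.
case: bx tE vE => /= tE vE.
- exists (v * x + y * s), (y * w); split=> //; rewrite mulrDr [v * (y * _)]mulrCA vE.
  by rewrite -tE; ring.
- exists (v * y + x * s), (x * w); split=> //; rewrite mulrDr [v * (x * _)]mulrCA vE.
  by rewrite -tE; ring.
Qed.

Lemma param_regular k s q : t ^+ k * s = q * F -> exists q', q = t ^+ k * q'.
Proof.
have [_ _ t0 reg _] := tP.
elim: k q => [|k IH] q; first by exists q; rewrite expr0 mul1r.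
rewrite exprS -mulrA => E; have [q1 q1E] := reg _ _ E.
move: E; rewrite q1E -mulrA => /(mulfI t0)/IH[q2 ->].
by exists q2; rewrite mulrA.
Qed.

Lemma param_cancel k s q : t ^+ k * s = q * F -> exists q', s = q' * F.
Proof.
have [_ _ t0 _ _] := tP.
move=> E; have [q' q'E] := param_regular E; exists q'.
by apply: (mulfI (expf_neq0 k t0)); rewrite E q'E mulrA.
Qed.

Lemma evF x : (x * F).[p.1, p.2] = 0.
Proof. by have [F0 _ _ _ _] := tP; rewrite evM F0 mulr0. Qed.

Lemma evt x k : (x * t ^+ k.+1).[p.1, p.2] = 0.
Proof. by have [_ t0 _ _ _] := tP; rewrite evM evXn t0 expr0n mulr0. Qed.

(** Subtracting the two presentations of [g] and cancelling [t ^+ k] leaves a multiple of [F]. It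
    vanishes at [p], but its value there would be that of [v' * u], a product of units. *)
Lemma val_at_lt g k k' : val_at p F t g k -> val_at p F t g k' -> ~ (k < k')%N.
Proof.
move=> [u [v [w [nu nv E]]]] [u' [v' [w' [nu' nv' E']]]] lt.
have : t ^+ k * (v' * u - v * u' * t ^+ (k' - k)) = (v * w' - v' * w) * F.
  have tk : t ^+ k' = t ^+ k * t ^+ (k' - k) by rewrite -exprD subnKC // ltnW.
  transitivity (v' * (u * t ^+ k) - v * (u' * t ^+ k')); first by rewrite tk; ring.
  have -> : u * t ^+ k = v * g - w * F by rewrite E addrK.
  have -> : u' * t ^+ k' = v' * g - w' * F by rewrite E' addrK.
  by ring.
move=> /param_cancel[q /(congr1 (fun s : {poly {poly K}} => s.[p.1, p.2]))].
rewrite evF evD evN -(subnSK lt) evt subr0 evM => /eqP.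
by rewrite mulf_eq0 (negPf nu) (negPf nv').
Qed.

Lemma val_at_uniq g k k' : val_at p F t g k -> val_at p F t g k' -> k = k'.
Proof.
by move=> h h'; case: (ltngtP k k') => // [/(val_at_lt h h')|/(val_at_lt h' h)].
Qed.

Lemma val_atM g g' k k' :
  val_at p F t g k -> val_at p F t g' k' -> val_at p F t (g * g') (k + k').
Proof.
move=> [u [v [w [nu nv E]]]] [u' [v' [w' [nu' nv' E']]]].
exists (u * u'), (v * v'), (w * (v' * g') + u * t ^+ k * w').
rewrite !evM !mulf_neq0 //; split=> //.
by rewrite mulrACA {1}E mulrDl E' exprD; ring.
Qed.

Lemma val_at0 g : g.[p.1, p.2] != 0 -> val_at p F t g 0.
Proof.
by exists g, 1, 0; rewrite !hornerC oner_neq0 mul1r mul0r addr0 expr0 mulr1.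
Qed.

Lemma val_at0_ev g : val_at p F t g 0 -> g.[p.1, p.2] != 0.
Proof.
move=> [u [v [w [nu nv /(congr1 (fun s : {poly {poly K}} => s.[p.1, p.2]))]]]].
rewrite evD evF addr0 expr0 mulr1 evM => E.
by apply: contraNneq nu => g0; rewrite -E g0 mulr0.
Qed.

Lemma val_atX g k n : val_at p F t g k -> val_at p F t (g ^+ n) (n * k).
Proof.
move=> h; elim: n => [|n IH]; last by rewrite exprS mulSn; exact: val_atM.
by apply: val_at0; rewrite expr0 !hornerC oner_neq0.
Qed.

(** Orders depend only on classes modulo [F], so normal forms keep the orders of the original
    polynomials. *)
Lemma val_at_cong g g' q k : g' = g + q * F -> val_at p F t g k -> val_at p F t g' k.
Proof.
move=> -> [u [v [w [nu nv E]]]]; exists u, v, (w + v * q); split=> //.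
by rewrite mulrDr E; ring.
Qed.

(** Induction on the order of the product. If [g] vanishes at [p], it equals [s * t] modulo [F] up
    to a unit, and cancelling one [t] gives [s * c] order one less. *)
Lemma val_at_divisor g c k : val_at p F t (g * c) k -> exists m, val_at p F t g m.
Proof.
elim: k g => [|k IH] g h.
  by exists 0%N; apply: val_at0; move: (val_at0_ev h); rewrite evM mulf_eq0 => /norP[].
case: (eqVneq g.[p.1, p.2] 0) => [g0|ng]; last by exists 0%N; exact: val_at0.
have [v [s [w [nv E]]]] := max_ideal_gen g0.
have [u1 [v1 [w1 [nu1 nv1 E1]]]] := h.
have : t ^+ 1 * (v1 * c * s - v * u1 * t ^+ k) = (v * w1 - v1 * c * w) * F.
  rewrite expr1; transitivity (v1 * c * (s * t) - v * (u1 * t ^+ k.+1)).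
    by rewrite exprS; ring.
  have -> : s * t = v * g - w * F by rewrite E addrK.
  have -> : u1 * t ^+ k.+1 = v1 * (g * c) - w1 * F by rewrite E1 addrK.
  by ring.
move=> /param_cancel[q /eqP]; rewrite subr_eq => /eqP sE.
have /IH[m [u2 [v2 [w2 [nu2 nv2 E2]]]]] : val_at p F t (s * c) k.
  exists (v * u1), v1, q; rewrite evM mulf_neq0 //; split=> //.
  by rewrite addrC -sE; ring.
exists m.+1, u2, (v2 * v), (w2 * t + v2 * w); rewrite evM mulf_neq0 //; split=> //.
by rewrite -mulrA E mulrDr mulrA E2 exprS; ring.
Qed.

Lemma val_at_cancel g c k m : val_at p F t (g * c) k -> val_at p F t c m ->
  (m <= k)%N /\ val_at p F t g (k - m).
Proof.
move=> h hc; have [j hj] := val_at_divisor h.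
by rewrite (val_at_uniq h (val_atM hj hc)) addnK leq_addl.
Qed.

(** Modulo [F] both coordinates are multiples of [t], so every monomial of degree [k] in them lies
    in the ideal of [t ^+ k]; conversely [t ^+ k] is itself one of these monomials. *)
Lemma max_ideal_pow_local k g :
  max_ideal_pow p F k g <-> local_ideal p F (t ^+ k) g%:F.
Proof.
have [F0 t0 tn0 reg [bx [v [s [w [tE nv E]]]]]] := tP.
split=> [[al [be [la lb ->]]]|].
  have idX b : local_ideal p F t (other_coord p b)%:F.
    have lt : local_ideal p F t t%:F.
      apply/local_ideal_poly; exists 1, 0, 1; rewrite !hornerC oner_neq0.
      by rewrite mul0r add0r.
    have [->|/negPf nb] := eqVneq b (~~ bx); first by rewrite -tE.
    have -> : b = bx by case: (b) nb; case: (bx).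
    by apply/local_ideal_poly; exists v, w, s; split=> //; rewrite E addrC.
  have idM i j x y : local_ideal p F (t ^+ i) x -> local_ideal p F (t ^+ j) y ->
      local_ideal p F (t ^+ (i + j)) (x * y).
    move=> [x1 [x2 [l1 l2 ->]]] [y1 [y2 [m1 m2 ->]]].
    exists (x1 * (y1 * F%:F + y2 * (t ^+ j)%:F) + x2 * (t ^+ i)%:F * y1), (x2 * y2).
    split; last by rewrite exprD tofracM; exact: local_ideal_mulE.
      by do ?[exact: local_ring_poly|exact: l1|exact: l2|exact: m1|exact: m2
             |apply: local_ringD|apply: local_ringM].
    exact: local_ringM.
  have idX1 b i : local_ideal p F (t ^+ i) ((other_coord p b) ^+ i)%:F.
    elim: i => [|i IH].
      by apply/local_ideal_poly; exists 1, 0, 1; rewrite !hornerC oner_neq0 mul0r add0r.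
    rewrite [other_coord p b ^+ _]exprS tofracM -addn1 addnC;
      by apply: idM => //; rewrite expr1.
  apply: local_idealD.
    exists al, 0; split=> //; last by rewrite mul0r addr0.
    by rewrite -tofrac0; exact: local_ring_poly.
  have: forall i : 'I_k.+1, true ->
      local_ideal p F (t ^+ k) (be i * (('X - p.1%:P%:P) ^+ i
                           * ('Y - p.2%:P%:P) ^+ (k - i))%:F).
    move=> i _; apply: local_idealMl => //.
    have {1}-> : k = (i + (k - i))%N by rewrite subnKC // -ltnS.
    by rewrite tofracM; apply: idM; [exact: (idX1 false)|exact: (idX1 true)].
  move=> H; elim/big_ind: _ => //; last by move=> x y; exact: local_idealD.
  by rewrite -tofrac0; apply/local_ideal_poly; exists 1, 0, 0;
    rewrite !hornerC oner_neq0 mulr0 !mul0r addr0.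
move=> [al [be [la lb gE]]].
(* Only the pure power of [t] is used: index [k] if [t] is the x-coordinate, index 0 if it is the
   y-coordinate. *)
exists al, (fun i => if i == (if bx then ord_max else ord0) then be else 0).
split=> // [i|].
  by case: ifP => // _; rewrite -tofrac0; exact: local_ring_poly.
rewrite gE; congr (_ + _).
rewrite (bigD1 (if bx then ord_max else ord0)) //= eqxx big1 ?addr0.
  congr (_ * _%:F); rewrite tE; case: (bx) => /=; first by rewrite subnn expr0 mulr1.
  by rewrite subn0 expr0 mul1r.
by move=> i /negPf ->; rewrite mul0r.
Qed.

(** If the coefficient of [t ^+ k] vanished at [p], it would be a multiple of [t] modulo [F], and
    [g] would lie in the next power of the maximal ideal. *)
Lemma ord_at_val g k : ord_at p F g k -> val_at p F t g k.
Proof.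
move=> [/max_ideal_pow_local/local_ideal_poly[v [w [s [nv E]]]] nk].
exists s, v, w; split=> //; last by rewrite E addrC.
apply: contra_notN nk => /eqP /max_ideal_gen[v' [s' [w' [nv' E']]]].
apply/max_ideal_pow_local/local_ideal_poly.
exists (v' * v), (v' * w + w' * t ^+ k), s'; rewrite evM mulf_neq0 //; split=> //.
by rewrite -mulrA E mulrDr [v' * (s * _)]mulrA E' exprS; ring.
Qed.

(** Taylor expansion of x/y in powers of [t], modulo [F] and [t ^+ k]. The coefficients are
    constants because the residue field at [p] is [K]. *)
Lemma taylor_mod (x y : {poly {poly K}}) k : y.[p.1, p.2] != 0 ->
  exists c : nat -> K, exists v s w, v.[p.1, p.2] != 0 /\
    v * (x - y * \sum_(i < k) (c i)%:P%:P * t ^+ i) = s * t ^+ k + w * F.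
Proof.
move=> ny; elim: k => [|k [c [v [s [w [nv E]]]]]].
  exists (fun => 0), 1, x, 0; rewrite !hornerC oner_neq0; split=> //.
  by rewrite big_ord0 expr0; ring.
(* The next Taylor coefficient, chosen so that [s - v * y * ck] vanishes at [p] and yields one more
   factor [t]. *)
pose ck := s.[p.1, p.2] / (v * y).[p.1, p.2].
have nvy : (v * y).[p.1, p.2] != 0 by rewrite evM mulf_neq0.
have /max_ideal_gen[v' [s' [w' [nv' E']]]] : (s - v * y * ck%:P%:P).[p.1, p.2] = 0.
  by rewrite evD evN evM evC /ck mulrC divfK // subrr.
exists (fun i => if (i < k)%N then c i else ck), (v' * v), s', (w' * t ^+ k + v' * w).
rewrite evM mulf_neq0 //; split=> //; rewrite big_ord_recr /= ltnn.
under eq_bigr => i _ do rewrite ltn_ord.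
set S := \sum_(i < k) _ in E *.
transitivity (v' * (v * (x - y * S) - v * y * ck%:P%:P * t ^+ k)); first by ring.
rewrite E; transitivity (v' * (s - v * y * ck%:P%:P) * t ^+ k + v' * w * F).
  by ring.
by rewrite E' exprS; ring.
Qed.

Lemma val_at_intersection g k : val_at p F t g k -> intersection_mult p F g k.
Proof.
move=> [u [v [w [nu nv E]]]].
exists (fun i => (t ^+ i)%:F); split=> [i|phi]; first exact: local_ring_poly.
move=> [x [y [ny ->]]].
(* Since [u] and [v] are units at [p], [g] and [t ^+ k] generate the same ideal modulo [F]. *)
have ideq z : local_ideal p F g z%:F <-> local_ideal p F (t ^+ k) z%:F.
  split=> /local_ideal_poly[v' [a [b [nv' E']]]]; apply/local_ideal_poly.
    exists (v' * v), (v * a + b * w), (b * u); rewrite evM mulf_neq0 //; split=> //.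
    by rewrite mulrAC E' -[RHS]addr0; ring: E.
  exists (v' * u), (u * a - b * w), (b * v); rewrite evM mulf_neq0 //; split=> //.
  by rewrite mulrAC E'; ring: E.
have [c [v' [s [w' [nv' E']]]]] := taylor_mod x k ny.
have sumE (k' : {ffun 'I_k -> K}) :
    \sum_(i < k) (k' i)%:P%:P%:F * (t ^+ i)%:F =
    (\sum_(i < k) (k' i)%:P%:P * t ^+ i)%:F.
  by rewrite rmorph_sum; apply: eq_bigr => i _; rewrite [in RHS]rmorphM.
have lid (k' : {ffun 'I_k -> K}) :
    local_ideal p F g (x%:F / y%:F - \sum_(i < k) (k' i)%:P%:P%:F * (t ^+ i)%:F)
    <-> local_ideal p F (t ^+ k) (x - y * \sum_(i < k) (k' i)%:P%:P * t ^+ i)%:F.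
  rewrite -ideq sumE; set S := \sum_(i < k) _.
  have fE : (x - y * S)%:F = y%:F * (x%:F / y%:F - S%:F).
    rewrite tofracB tofracM; exact: mul_frac_sub (ev_neq0 ny).
  split=> h; first by rewrite fE; apply: local_idealMl => //; exact: local_ring_poly.
  have -> : x%:F / y%:F - S%:F = y%:F^-1 * (x - y * S)%:F.
    rewrite fE; exact: esym (mulKf (ev_neq0 ny) _).
  by apply: local_idealMl => //; exists 1, y; rewrite tofrac1 mul1r.
exists [ffun i : 'I_k => c i]; split.
  apply/lid; under eq_bigr => i _ do rewrite ffunE.
  by apply/local_ideal_poly; exists v', w', s; split=> //; rewrite E' addrC.
move=> k' /lid/local_ideal_poly[v1 [a1 [b1 [nv1 E1]]]].
(* The difference of two coefficient vectors, extended by 0 to all natural indices. *)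
pose e i := if insub i is Some j then c i - k' j else 0.
have eE (i : 'I_k) : e i = c i - k' i by rewrite /e valK.
have : exists v2 a2 b2, v2.[p.1, p.2] != 0 /\
    v2 * \sum_(i < k) (e i)%:P%:P * t ^+ i = a2 * F + b2 * t ^+ k.
  exists (v' * v1 * y), (v' * a1 - v1 * w'), (v' * b1 - v1 * s).
  rewrite !evM !mulf_neq0 //; split=> //.
  under eq_bigr => i _ do rewrite eE !polyCB mulrBl.
  rewrite sumrB; set S := \sum_(i < k) _ in E' *; set S1 := \sum_(i < k) _ in E1 *.
  transitivity (v' * (v1 * (x - y * S1)) - v1 * (v' * (x - y * S))); first by ring.
  by rewrite E1 E'; ring.
move=> [v2 [a2 [b2 [nv2 E2]]]].
suff e0 : forall i, (i < k)%N -> e i = 0.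
  by apply/ffunP => i; rewrite ffunE; apply/eqP; rewrite -subr_eq0 -eE e0.
(* Once the lower coefficients are known to vanish, [t ^+ i] can be cancelled. As [i < k],
   evaluation at [p] then leaves only [v2 * e i], with [v2] a unit. *)
move=> i; have [m] := ubnP i; elim: m i => // m IH i; rewrite ltnS => le_im lt_ik.
have split_e : \sum_(j < k) (e j)%:P%:P * t ^+ j =
    t ^+ i * ((e i)%:P%:P + t * \sum_(i.+1 <= j < k) (e j)%:P%:P * t ^+ (j - i.+1)).
  rewrite -(big_mkord xpredT (fun j => (e j)%:P%:P * t ^+ j)).
  rewrite (big_cat_nat (n := i)) //=; last exact: ltnW.
  rewrite big_nat_cond big1 ?add0r; last first.
    by move=> j /andP[/andP[_ lt_ji] _]; 
      rewrite IH ?mul0r // ?(leq_trans lt_ji) // ltnW ?(ltn_trans lt_ji).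
  rewrite big_ltn // mulrDr mulrC; congr (_ + _).
  rewrite mulrA -exprSr mulr_sumr; apply: eq_big_nat => j /andP[lt_ij _].
  by rewrite mulrCA -exprD subnKC.
move: E2; rewrite split_e => E2.
set S := \sum_(_ <= _ < _) _ in E2.
have : t ^+ i * (v2 * ((e i)%:P%:P + t * S) - b2 * t ^+ (k - i)) = a2 * F.
  rewrite mulrBr mulrCA E2 [t ^+ i * (b2 * _)]mulrCA -exprD subnKC ?addrK //.
  exact: ltnW.
move=> /param_cancel[q /(congr1 (fun s : {poly {poly K}} => s.[p.1, p.2]))].
rewrite evF evD evN -(subnSK lt_ik) evt subr0 evM evD evC.
have [_ t0 _ _ _] := tP.
rewrite evM t0 mul0r addr0 => /eqP; rewrite mulf_eq0 (negPf nv2) /=.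
by move/eqP.
Qed.

End Param.
End LocalRing.

(** * The charts of the projective plane *)

Section Charts.
Variable K : fieldType.
Implicit Types (g : {poly {poly K}}) (s : 3.-tuple {poly {poly K}}).
Implicit Types (G H : {mpoly K[3]}).

Lemma mpoly_substE s G : mpoly_subst s G = mmap (polyC \o polyC) (tnth s) G.
Proof. by []. Qed.

Lemma mpoly_substD s G H : mpoly_subst s (G + H) = mpoly_subst s G + mpoly_subst s H.
Proof. by rewrite !mpoly_substE raddfD. Qed.

Lemma mpoly_substN s G : mpoly_subst s (- G) = - mpoly_subst s G.
Proof. by rewrite !mpoly_substE raddfN. Qed.

Lemma mpoly_substM s G H : mpoly_subst s (G * H) = mpoly_subst s G * mpoly_subst s H.
Proof. by rewrite !mpoly_substE rmorphM. Qed.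

Lemma mpoly_substXn s G k : mpoly_subst s (G ^+ k) = mpoly_subst s G ^+ k.
Proof. by rewrite !mpoly_substE rmorphXn. Qed.

Lemma mpoly_substZ s x G : mpoly_subst s (x *: G) = x%:P%:P * mpoly_subst s G.
Proof. by rewrite !mpoly_substE mmapZ. Qed.

Lemma mpoly_substX s i : mpoly_subst s 'X_i = tnth s i.
Proof. by rewrite mpoly_substE mmapX mmap1U. Qed.

Lemma mpoly_subst_sum s (I : Type) (r : seq I) (P : pred I) (E : I -> {mpoly K[3]}) :
  mpoly_subst s (\sum_(i <- r | P i) E i) = \sum_(i <- r | P i) mpoly_subst s (E i).
Proof. by rewrite !mpoly_substE raddf_sum. Qed.

Definition mpoly_substP := (mpoly_substD, mpoly_substN, mpoly_substM,
  mpoly_substXn, mpoly_substZ, mpoly_substX).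

Lemma mpoly_subst_homogenize s g : mpoly_subst s (homogenize g) =
  \sum_(i < size g) \sum_(j < size g`_i) (g`_i`_j)%:P%:P *
    (tnth s iX ^+ i * tnth s iY ^+ j * tnth s iZ ^+ (total_degree g - (i + j))).
Proof.
rewrite mpoly_subst_sum; apply: eq_bigr => i _.
rewrite mpoly_subst_sum; apply: eq_bigr => j _.
by rewrite !mpoly_substP.
Qed.

Lemma poly2E g :
  g = \sum_(i < size g) \sum_(j < size g`_i) (g`_i`_j)%:P%:P * ('X ^+ i * 'Y ^+ j).
Proof.
rewrite -[LHS]coefK poly_def; apply: eq_bigr => i _.
rewrite -[in LHS](coefK g`_i) poly_def scaler_suml; apply: eq_bigr => j _.
by rewrite -mul_polyC -mul_polyC !rmorphM /= rmorphXn /=; ring.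
Qed.

Variables (a b c : K).
Local Notation W := (weierstrass a b c).
Implicit Types (P : cubic_pt a b c).

(** The cubic in the chart at O: ['X] and ['Y] stand for X/Y and Z/Y. *)
Definition O_cubic : {poly {poly K}} :=
  'Y - ('X ^+ 3 + a%:P%:P * 'X ^+ 2 * 'Y + b%:P%:P * 'X * 'Y ^+ 2 + c%:P%:P * 'Y ^+ 3).

Lemma chart_affine P x y G : pt_val P = Some (x, y) ->
  chart P G = mpoly_subst [tuple 'X; 'Y; 1] G.
Proof. by rewrite /chart => ->. Qed.

Lemma weierstrassE :
  W = 'Y ^+ 2 - ('X ^+ 3 + a%:P%:P * 'X ^+ 2 + b%:P%:P * 'X + c%:P%:P).
Proof.
rewrite -[LHS]opprK oppr_weierstrass -!mul_polyC rmorphB rmorphXn /=; ring.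
Qed.

Lemma chart_affine_cubic P x y : pt_val P = Some (x, y) ->
  chart P (cubic_form a b c) = W.
Proof.
move=> /chart_affine ->; rewrite weierstrassE !mpoly_substP !(tnth_nth 0) /=; ring.
Qed.

Lemma chart_affine_homogenize P x y g : pt_val P = Some (x, y) ->
  chart P (homogenize g) = g.
Proof.
move=> /chart_affine ->; rewrite mpoly_subst_homogenize [RHS]poly2E.
apply: eq_bigr => i _; apply: eq_bigr => j _.
by rewrite !(tnth_nth 0) /= expr1n mulr1.
Qed.

Lemma chart_affine_Zn P x y r : pt_val P = Some (x, y) ->
  chart P ('X_iZ ^+ r) = 1.
Proof.
by move=> /chart_affine ->; rewrite !mpoly_substP (tnth_nth 0) /= expr1n.
Qed.

Lemma chart_O_cubic : chart (O_pt a b c) (cubic_form a b c) = O_cubic.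
Proof.
by rewrite /chart /O_cubic !mpoly_substP !(tnth_nth 0) /=; ring.
Qed.

Lemma chart_O_Zn r : chart (O_pt a b c) ('X_iZ ^+ r) = 'Y ^+ r.
Proof. by rewrite /chart !mpoly_substP (tnth_nth 0). Qed.

Lemma chart_O_homogenize g : chart (O_pt a b c) (homogenize g) =
  \sum_(i < size g) \sum_(j < size g`_i) (g`_i`_j)%:P%:P *
    ('X ^+ i * 'Y ^+ (total_degree g - (i + j))).
Proof.
rewrite /chart mpoly_subst_homogenize.
apply: eq_bigr => i _; apply: eq_bigr => j _.
by rewrite !(tnth_nth 0) /= expr1n mulr1.
Qed.

Lemma mderiv_var (i j : 'I_3) : ('X_j : {mpoly K[3]})^`M(i) = (i == j)%:R.
Proof.
rewrite mderivX mnm1E eq_sym; case: eqVneq => [->|_]; last by rewrite scale0r.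
by rewrite scale1r -{1}[U_(j)%MM]add0m addmK mpolyX0.
Qed.

(** At a double root x of f all three partial derivatives of the form would vanish at [x, 0, 1]. *)
Lemma smooth_simple_root x : smooth_curve (cubic_form a b c) ->
  (cubic_poly a b c).[x] = 0 -> (cubic_poly a b c)^`().[x] != 0.
Proof.
move=> sm f0; apply/eqP => df0.
have := sm (tnth [tuple x; 0; 1]).
have fE : x ^+ 3 + a * x ^+ 2 + b * x + c = 0.
  by rewrite -f0 /cubic_poly !hornerE.
have dfE : 3 * x ^+ 2 + 2 * a * x + b = 0.
  rewrite -df0 /cubic_poly !derivE !hornerE /=; ring.
case=> [||i].
- by exists iZ; rewrite (tnth_nth 0) oner_neq0.
- rewrite /cubic_form !(mevalD, mevalN, mevalM, mevalZ, rmorphXn, mevalXU) /= !(tnth_nth 0) /=.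
  transitivity (- (x ^+ 3 + a * x ^+ 2 + b * x + c)); first by ring.
  by rewrite fE oppr0.
rewrite /cubic_form !expr2 !exprS !expr0.
rewrite !(mderivD, mderivN, mderivM, mderivZ, mderiv_var, mderivC).
rewrite -!mpolyC1 ?mderivC ?mpolyC1.
rewrite !(mevalD, mevalN, mevalM, mevalZ, mevalXU, meval1, rmorph_nat, meval0) /=.
rewrite !(tnth_nth 0) /=.
case: i => -[|[|[|//]]] lti; rewrite /eq_op /= => /eqP[].
- transitivity (- (3 * x ^+ 2 + 2 * a * x + b)); first by ring.
  by rewrite dfE oppr0.
- by ring.
(* Euler's relation expresses the Z-derivative through f(x) and f'(x). *)
- transitivity (- (3 * (x ^+ 3 + a * x ^+ 2 + b * x + c) - x * (3 * x ^+ 2 + 2 * a * x + b))).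
    by ring.
  by rewrite fE dfE !mulr0 subr0 oppr0.
Qed.

End Charts.

(** * Uniformizers on the cubic *)

Section Params.
Variable K : fieldType.
Implicit Types (g q s F : {poly {poly K}}).

(** On the line x = [x0], [F] restricts to a nonzero element of the domain of polynomials in y, so
    [q] must restrict to 0. *)
Lemma regular_X (x0 : K) F s q : F.[x0%:P] != 0 ->
  ('X - x0%:P%:P) * s = q * F -> exists q', q = ('X - x0%:P%:P) * q'.
Proof.
move=> nF /(congr1 (fun u : {poly {poly K}} => u.[x0%:P])) /eqP.
rewrite !hornerM !hornerE subrr mul0r eq_sym mulf_eq0 (negPf nF) orbF.
by move=> /factor_theorem[q' ->]; exists q'; rewrite mulrC.
Qed.

Lemma regular_Y (y0 : K) F s q : (swapXY F).[y0%:P] != 0 ->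
  ('Y - y0%:P%:P) * s = q * F -> exists q', q = ('Y - y0%:P%:P) * q'.
Proof.
have swY : swapXY ('Y - y0%:P%:P) = 'X - y0%:P%:P.
  by rewrite raddfB /= swapXY_Y swapXY_polyC map_polyC.
move=> nF /(congr1 swapXY); rewrite !rmorphM /= [swapXY (_ - _)]swY.
move=> /(regular_X nF)[q' qE]; exists (swapXY q').
by apply: (can_inj swapXYK); rewrite qE rmorphM /= [swapXY (_ - _)]swY swapXYK.
Qed.

Variables a b c : K.
Local Notation W := (weierstrass a b c).
Local Notation f := (cubic_poly a b c).

Lemma ev_map_polyC (r : {poly K}) (x y : K) : r^:P.[x, y] = r.[x].
Proof. by rewrite horner_map /= hornerC. Qed.

Lemma ev_W (x y : K) : W.[x, y] = y ^+ 2 - f.[x].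
Proof.
rewrite /weierstrass (evD (x, y)) (evN (x, y)) ev_map_polyC (evXn (x, y)).
by rewrite hornerC hornerX.
Qed.

(** Where y = 0 the tangent line is vertical and y is the uniformizer; elsewhere it is x - [p.1]. *)
Definition affine_param (p : K * K) : {poly {poly K}} :=
  if p.2 == 0 then 'Y - p.2%:P%:P else 'X - p.1%:P%:P.

(** The difference quotient of f at [x0], with value f'([x0]) there. *)
Definition cubic_quot (x0 : K) : {poly K} :=
  'X ^+ 2 + (x0 + a) *: 'X + (x0 ^+ 2 + a * x0 + b)%:P.

Lemma cubic_factor x0 : f - (f.[x0])%:P = ('X - x0%:P) * cubic_quot x0.
Proof.
rewrite /cubic_poly /cubic_quot !hornerE -!mul_polyC.
by rewrite !(rmorphD, rmorphM, rmorphXn) /=; ring.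
Qed.

Lemma horner_cubic_quot (x0 : K) : (cubic_quot x0).[x0] = f^`().[x0].
Proof. by rewrite /cubic_poly /cubic_quot !derivE !hornerE /=; ring. Qed.

Lemma weierstrass_at x0 :
  W = 'Y ^+ 2 - (f.[x0])%:P%:P - ('X - x0%:P%:P) * (cubic_quot x0)^:P.
Proof.
rewrite /weierstrass -[in LHS](subrK (f.[x0])%:P f) cubic_factor.
rewrite rmorphD rmorphM rmorphB /= map_polyX !map_polyC /=.
by rewrite opprD addrA addrAC.
Qed.

(** On the curve (y - y0)(y + y0) = (x - x0) [cubic_quot x0]. If y0 is nonzero, y + y0 is a unit
    with value 2 y0; if y0 = 0, the quotient is a unit because the root of f is simple. *)
Lemma affine_local_param (x0 y0 : K) : 2 != 0 :> K ->
  y0 ^+ 2 = f.[x0] -> (f.[x0] = 0 -> f^`().[x0] != 0) ->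
  local_param (x0, y0) W (affine_param (x0, y0)).
Proof.
move=> n2 e sm; have WE := weierstrass_at x0.
rewrite /affine_param /=; case: eqVneq => [y00|ny0].
  have fx0 : f.[x0] = 0 by rewrite -e y00 expr0n.
  split=> /=.
  - by rewrite ev_W e subrr.
  - by rewrite !hornerE subrr.
  - by rewrite -polyCB polyC_eq0 polyXsubC_eq0.
  - move=> s q; apply: regular_Y.
    rewrite swapXY_weierstrass.
    rewrite hornerD hornerN hornerC horner_exp hornerX y00 polyC0 expr0n sub0r oppr_eq0.
    by apply: contraNneq (sm fx0) => ->; rewrite deriv0 horner0.
  exists false, (cubic_quot x0)^:P, 'Y, (- 1); split=> //=.
    by rewrite ev_map_polyC horner_cubic_quot sm.
  by rewrite WE fx0 y00 polyC0; ring.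
split=> /=.
- by rewrite ev_W e subrr.
- by rewrite !hornerE subrr.
- by rewrite polyXsubC_eq0.
- move=> s q; apply: regular_X.
  rewrite /weierstrass hornerD hornerN horner_exp hornerC horner_map /=.
  rewrite -size_poly_gt0 size_polyDl ?size_polyXn // size_polyN.
  by rewrite (leq_ltn_trans (size_polyC_leq1 _)).
exists true, ('Y + y0%:P%:P), (cubic_quot x0)^:P, 1; split=> //=.
  by rewrite !hornerE -mulr2n -mulr_natl mulf_neq0.
by rewrite WE -e !rmorphXn; ring.
Qed.

Local Notation O := (0 : K, 0 : K).

(** The unit relating the coordinates at O: on the cubic, (Z/Y) [O_unit] = (X/Y)^3. Thus X/Y is a
    uniformizer and Z/Y has order 3. *)
Definition O_unit : {poly {poly K}} :=
  1 - a%:P%:P * 'X ^+ 2 - b%:P%:P * 'X * 'Y - c%:P%:P * 'Y ^+ 2.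

Lemma O_cubicE : 'Y * O_unit = 'X ^+ 3 + O_cubic a b c.
Proof. by rewrite /O_unit /O_cubic; ring. Qed.

Lemma ev_O_unit : O_unit.[0, 0] = 1.
Proof. by rewrite /O_unit !hornerE /=; ring. Qed.

Lemma O_local_param : local_param O (O_cubic a b c) ('X - 0%:P%:P).
Proof.
split=> /=.
- by rewrite /O_cubic !hornerE /=; ring.
- by rewrite hornerD hornerN hornerX hornerC subrr horner0.
- by rewrite polyXsubC_eq0.
- move=> s q; apply: regular_X.
  have -> : (O_cubic a b c).[0%:P] = 'X - c%:P * 'X ^+ 3.
    by rewrite /O_cubic !hornerE /=; ring.
  apply/eqP => /polyP/(_ 1); rewrite coefB coefX coefCM coefXn coef0 mulr0 subr0.
  by move/eqP; rewrite oner_eq0.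
exists true, O_unit, ('X ^+ 2), 1; rewrite /= ev_O_unit oner_neq0; split=> //.
by rewrite !polyC0 !subr0 mulrC O_cubicE; ring.
Qed.

End Params.

(** * Weights and orders at O *)

Section Weights.
Variable K : fieldType.
Implicit Types (g q s F h : {poly {poly K}}).

(* The weight of a monomial is its pole order at O, where x and y have poles of
   order 2 and 3. *)
Definition wlt g m := forall i j, g`_i`_j != 0 -> (2 * i + 3 * j < m)%N.
Definition wexact g w :=
  wlt g w.+1 /\ exists i j, g`_i`_j != 0 /\ (2 * i + 3 * j)%N = w.

Lemma wlt0 m : wlt 0 m.
Proof. by move=> i j; rewrite !coef0 eqxx. Qed.

Lemma wltD g h m : wlt g m -> wlt h m -> wlt (g + h) m.
Proof.
move=> wg wh i j; rewrite !coefD.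
have [->|/wg //] := eqVneq g`_i`_j 0; rewrite add0r; exact: wh.
Qed.

Lemma wltZ (x : K) g m : wlt g m -> wlt (x%:P%:P * g) m.
Proof.
move=> wg i j; rewrite !coefCM => n0; apply: wg.
by apply: contraNneq n0 => ->; rewrite mulr0.
Qed.

Lemma coefXY k l i j : ('X ^+ k * 'Y ^+ l : {poly {poly K}})`_i`_j = ((i == k) && (j == l))%:R.
Proof.
rewrite -rmorphXn /= coefMC coefXn; case: eqP => _ /=; last by rewrite mul0r coef0.
by rewrite mul1r coefXn.
Qed.

Lemma wlt_monomial k l m : (2 * k + 3 * l < m)%N -> wlt ('X ^+ k * 'Y ^+ l) m.
Proof.
move=> lt i j; rewrite coefXY.
by have [->|_] := eqVneq i k; have [->|_] := eqVneq j l; rewrite /= ?eqxx.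
Qed.

(** The search for a monomial of weight [w] is finite, as both of its exponents are at most [w]. *)
Lemma wexact_or g w : wlt g w.+1 -> wlt g w \/ wexact g w.
Proof.
move=> wg.
have [/existsP[i /existsP[j /andP[n0 /eqP e]]]|nex] := boolP [exists i : 'I_w.+1,
    exists j : 'I_w.+1, (g`_i`_j != 0) && (2 * i + 3 * j == w)%N].
  by right; split=> //; exists i, j.
left=> i j n0; have := wg _ _ n0; rewrite ltnS leq_eqVlt => /orP[/eqP e|//].
have li : (i < w.+1)%N by lia.
have lj : (j < w.+1)%N by lia.
case/negP: nex; apply/existsP; exists (Ordinal li); apply/existsP; exists (Ordinal lj).
by rewrite /= n0 e eqxx.
Qed.

Lemma wexact_not g w : wexact g w -> ~ wlt g w.
Proof. by move=> [_ [i [j [n0 <-]]]] /(_ _ _ n0); rewrite ltnn. Qed.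

Lemma coef_neq0_size g i j : g`_i`_j != 0 -> (i < size g)%N /\ (j < size (g`_i)%R)%N.
Proof.
move=> n0; split; rewrite ltnNge; apply: contra n0 => h.
  by rewrite [g`_i]nth_default // coef0.
by rewrite nth_default.
Qed.

Lemma total_degree_ge g i j : g`_i`_j != 0 -> (i + j <= total_degree g)%N.
Proof.
move=> n0; have [li lj] := coef_neq0_size n0.
apply: (bigmax_sup (Ordinal li)) => /=.
  by apply: contraNneq n0 => ->; rewrite coef0.
by rewrite leq_add2l -ltnS (leq_trans lj) // leqSpred.
Qed.

Lemma total_degree_le g m : (forall i j, g`_i`_j != 0 -> (i + j <= m)%N) ->
  (total_degree g <= m)%N.
Proof.
move=> H; apply/bigmax_leqP => i n0; apply: H.
by rewrite -lead_coefE lead_coef_eq0.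
Qed.

Lemma coef_linearY (r0 r1 : {poly K}) i j :
  (r0^:P + r1^:P * 'Y)`_i`_j = if j == 0%N then r0`_i else if j == 1%N then r1`_i else 0.
Proof.
rewrite coefD coefMC !coef_map /= coefD coefC coefMX coefC.
by case: j => [|[|j]]; rewrite /= ?addr0 ?add0r.
Qed.

Lemma coef_linearY_lt2 (r0 r1 : {poly K}) i j :
  (r0^:P + r1^:P * 'Y)`_i`_j != 0 -> (j < 2)%N.
Proof. by rewrite coef_linearY; case: j => [|[|j]] //=; rewrite eqxx. Qed.

Variables a b c : K.
Local Notation W := (weierstrass a b c).
Local Notation f := (cubic_poly a b c).
Local Notation O := (0 : K, 0 : K).
Local Notation FO := (O_cubic a b c).
Local Notation U := (O_unit a b c).

Lemma size_cubic : size f = 4%N.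
Proof.
rewrite /cubic_poly -!addrA size_polyDl size_polyXn // ltnS.
rewrite (leq_trans (size_polyD _ _)) // geq_max (leq_trans (size_scale_leq _ _)) ?size_polyXn //=.
rewrite (leq_trans (size_polyD _ _)) // geq_max (leq_trans (size_scale_leq _ _)) ?size_polyX //=.
exact: leq_trans (size_polyC_leq1 _) _.
Qed.

Lemma regroup (R : comNzRingType) (A B C D G : R) :
  G * D * A * (C * B) = A * B * (G * (D * C)).
Proof. by ring. Qed.

Lemma regroup_cong (R : comNzRingType) (A D E F G Q T V : R) : D * E = V * T ->
  G * D * A * (E + Q * F) = G * (V * A) * T + G * D * A * Q * F.
Proof.
move=> DE; transitivity (G * A * (D * E) + G * D * A * Q * F); first by ring.
by rewrite DE; ring.
Qed.

Lemma O_cubic_pow e : exists q, ('Y * U) ^+ e = 'X ^+ (3 * e) + q * FO.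
Proof.
elim: e => [|e [q E]]; first by exists 0; rewrite muln0 !expr0; ring.
exists (('X ^+ 3 + FO) * q + 'X ^+ (3 * e)).
rewrite exprS E O_cubicE mulnS exprD; ring.
Qed.

(** With r the total degree, multiplication by [O_unit ^+ r] turns the term of x^i y^j into a unit
    times (X/Y)^(3r - (2i + 3j)), modulo the cubic. The heaviest monomial therefore gives the order
    3r - w. *)
Lemma O_val_homogenize (r0 r1 : {poly K}) w : wexact (r0^:P + r1^:P * 'Y) w ->
  (w <= 3 * total_degree (r0^:P + r1^:P * 'Y))%N /\
  val_at O FO ('X - 0%:P%:P) (chart (O_pt a b c) (homogenize (r0^:P + r1^:P * 'Y)))
    (3 * total_degree (r0^:P + r1^:P * 'Y) - w).
Proof.
set g := (_ + _); move=> [wg [i0 [j0 [n0 e0]]]].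
have lew : (w <= 3 * total_degree g)%N by have := total_degree_ge n0; lia.
split=> //; rewrite chart_O_homogenize polyC0 subr0; set r := total_degree g.
have [li0 lj0] := coef_neq0_size n0.
(* The cofactor of (X/Y)^(3r - w). At O only the terms of weight exactly [w] survive. *)
pose S : {poly {poly K}} := \sum_(i < size g) \sum_(j < size g`_i)
  (g`_i`_j)%:P%:P * ('X ^+ (w - (2 * i + 3 * j)) * U ^+ (i + j)).
have SE : S.[0, 0] = g`_i0`_j0.
  have tE i j : ((g`_i`_j)%:P%:P * ('X ^+ (w - (2 * i + 3 * j)) * U ^+ (i + j))).[0, 0]
     = g`_i`_j * ((i == i0) && (j == j0))%:R.
    rewrite !(evM O) (evC O) !(evXn O) ev_O_unit expr1n mulr1 hornerX horner0.
    have [->|nz] := eqVneq g`_i`_j 0; first by rewrite !mul0r.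
    have lt := wg _ _ nz; rewrite expr0n; congr (_ * _%:R); congr nat_of_bool.
    (* As j is 0 or 1, the parity of the weight determines j and then i, so the monomial of weight
       [w] is unique and nothing cancels. *)
    have lj := coef_linearY_lt2 nz; have lj' := coef_linearY_lt2 n0.
    by apply/eqP/andP => [|[/eqP-> /eqP->]]; [split; apply/eqP|]; lia.
  rewrite /S !horner_sum (bigD1 (Ordinal li0)) //= [X in _ + X]big1 ?addr0.
    rewrite !horner_sum (bigD1 (Ordinal lj0)) //= [X in _ + X]big1 ?addr0.
      by rewrite tE !eqxx mulr1.
    by move=> j nj; rewrite tE -(inj_eq val_inj) /= in nj *; rewrite (negPf nj) andbF mulr0.
  move=> i ni; rewrite !horner_sum big1 // => j _.
  by rewrite tE -(inj_eq val_inj) /= in ni *; rewrite (negPf ni) mulr0.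
suff [q E] : exists q, U ^+ r * \sum_(i < size g) \sum_(j < size g`_i)
    (g`_i`_j)%:P%:P * ('X ^+ i * 'Y ^+ (r - (i + j))) = S * 'X ^+ (3 * r - w) + q * FO.
  exists S, (U ^+ r), q; split=> //=; first by rewrite SE.
  by rewrite (evXn O) ev_O_unit expr1n oner_neq0.
rewrite mulr_sumr /S mulr_suml.
have congS I (A B : I -> {poly {poly K}}) (s : seq I) :
    (forall i, exists q, A i = B i + q * FO) ->
    exists q, \sum_(i <- s) A i = \sum_(i <- s) B i + q * FO.
  move=> H; elim: s => [|i s [q E]]; first by exists 0; rewrite !big_nil; ring.
  by have [q' E'] := H i; exists (q' + q); rewrite !big_cons E E'; ring.
apply: (congS) => i; rewrite mulr_sumr mulr_suml; apply: (congS) => j.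
have [->|nz] := eqVneq g`_i`_j 0; first by exists 0; rewrite polyC0 ?polyC0 !(mul0r, mulr0, addr0).
have lt := wg _ _ nz; have le := total_degree_ge nz; rewrite -/r in le lew.
have [q E] := O_cubic_pow (r - (i + j)).
exists ((g`_i`_j)%:P%:P * 'X ^+ i * U ^+ (i + j) * q).
have -> : U ^+ r = U ^+ (i + j) * U ^+ (r - (i + j)) by rewrite -exprD subnKC.
have <- : (g`_i`_j)%:P%:P * 'X ^+ i * U ^+ (i + j) * ('Y * U) ^+ (r - (i + j)) =
    U ^+ (i + j) * U ^+ (r - (i + j)) * ((g`_i`_j)%:P%:P * ('X ^+ i * 'Y ^+ (r - (i + j)))).
  by rewrite exprMn; exact: regroup.
rewrite E; apply: regroup_cong; rewrite -!exprD; congr (_ ^+ _); lia.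
Qed.

End Weights.

(** * Norms and normal forms *)

Section Norm.
Variable K : fieldType.
Implicit Types (g q h : {poly {poly K}}) (s : {poly K}).
Variables a b c : K.
Local Notation W := (weierstrass a b c).
Local Notation f := (cubic_poly a b c).

(** The pullback under the involution, sending y to -y. *)
Definition conjY : {poly {poly K}} -> {poly {poly K}} := map_poly (comp_poly (- 'X)).

Lemma conjYM g h : conjY (g * h) = conjY g * conjY h.
Proof. exact: rmorphM. Qed.

Lemma conjYD g h : conjY (g + h) = conjY g + conjY h.
Proof. exact: rmorphD. Qed.

Lemma conjYN g : conjY (- g) = - conjY g.
Proof. exact: rmorphN. Qed.

Lemma conjY_map_polyC (r : {poly K}) : conjY r^:P = r^:P.
Proof.
by rewrite /conjY -map_poly_comp; apply: eq_map_poly => x /=; rewrite comp_polyC.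
Qed.

Lemma conjY_Y : conjY 'Y = - 'Y.
Proof. by rewrite /conjY map_polyC /= comp_polyX polyCN. Qed.

(* [s] is the norm of [g], from C(E) down to C(x). *)
Definition is_norm g (s : {poly K}) := exists q, g * conjY g = s^:P + q * W.

Lemma is_norm_linear (r0 r1 : {poly K}) :
  is_norm (r0^:P + r1^:P * 'Y) (r0 ^+ 2 - f * r1 ^+ 2).
Proof.
exists (- r1^:P ^+ 2).
rewrite conjYD conjYM !conjY_map_polyC conjY_Y !expr2 rmorphB !rmorphM /=.
by rewrite /weierstrass; ring.
Qed.

Lemma is_normM g h s s' : is_norm g s -> is_norm h s' -> is_norm (g * h) (s * s').
Proof.
move=> [q E] [q' E']; exists (s^:P * q' + q * (s'^:P + q' * W)).
by rewrite conjYM mulrACA E E' rmorphM /=; ring.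
Qed.

Lemma is_normX g s n : is_norm g s -> is_norm (g ^+ n) (s ^+ n).
Proof.
move=> h; elim: n => [|n IH]; last by rewrite !exprS; exact: is_normM.
by exists 0; rewrite expr0 /conjY !rmorph1 /=; ring.
Qed.

Lemma is_norm_cong g h q s : h = g + q * W -> is_norm g s -> is_norm h s.
Proof.
move=> -> [q' E]; exists (q' + q * conjY (g + q * W) + g * conjY q * 1).
have WE : conjY W = W.
  rewrite /weierstrass conjYD expr2 conjYM conjY_Y conjYN conjY_map_polyC.
  by ring.
transitivity (g * conjY g + (q * conjY (g + q * W) + g * conjY q) * W).
  by rewrite conjYD conjYM WE; ring.
by rewrite E; ring.
Qed.

(** A polynomial in x alone is its own first normal form, whereas a multiple of y^2 - f has normal
    form 0. *)
Lemma map_polyC_W_eq0 (s : {poly K}) q : s^:P = q * W -> s = 0.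
Proof.
move=> E.
have h1 : NF1 a b c s^:P = 0^:P + 0^:P * 'Y.
  by apply/NF1P; exists q; rewrite E !map_poly0 mul0r !addr0.
have h2 : NF1 a b c s^:P = s^:P + 0^:P * 'Y.
  by apply/NF1P; exists 0; rewrite !map_poly0 !mul0r !(addr0, add0r).
move: h2; rewrite h1 !map_poly0 !mul0r !addr0 => /esym/eqP.
by rewrite map_polyC_eq0 => /eqP.
Qed.

Lemma is_norm_uniq g s s' : is_norm g s -> is_norm g s' -> s = s'.
Proof.
move=> [q E] [q' E']; apply/eqP; rewrite -subr_eq0; apply/eqP.
apply: (@map_polyC_W_eq0 _ (q' - q)); rewrite rmorphB /= mulrBl.
have -> : s^:P = g * conjY g - q * W by rewrite E addrK.
by rewrite E'; ring.
Qed.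

Lemma size_sqr (r : {poly K}) z : size r = z -> size (r ^+ 2) = (2 * z).-1.
Proof.
move=> zE; have [r0|n0] := eqVneq r 0; first by rewrite -zE r0 expr0n size_poly0.
by rewrite expr2 size_mul // zE addnn mul2n.
Qed.

Lemma size_cubic_sqr (r : {poly K}) z : r != 0 -> size r = z ->
  size (f * r ^+ 2) = (2 * z + 2)%N.
Proof.
move=> n0 zE; have p : (0 < z)%N by rewrite -zE size_poly_gt0.
have -> : size (f * r ^+ 2) = (size f + size (r ^+ 2)%R).-1.
  by apply: size_mul; rewrite ?expf_neq0 // -size_poly_gt0 size_cubic.
by rewrite (size_sqr zE) size_cubic; lia.
Qed.

(** Nonzero r0^2 has even degree and nonzero f r1^2 odd degree, so they cannot be equal. *)
Lemma norm_eq0 (r0 r1 : {poly K}) : r0 ^+ 2 - f * r1 ^+ 2 = 0 -> r0 = 0 /\ r1 = 0.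
Proof.
move=> /eqP; rewrite subr_eq0 => /eqP E.
have [r10|n1] := eqVneq r1 0.
  have : r0 ^+ 2 == 0 by rewrite E r10 expr0n mulr0.
  by rewrite expf_eq0 => /eqP.
have := size_cubic_sqr n1 (erefl _); rewrite -E (size_sqr (erefl _)).
by move: (size r0) (size r1) => z0 z1; lia.
Qed.

(** The same parity excludes cancellation of leading terms: the degree of the norm is the larger of
    2 deg r0 and 2 deg r1 + 3, which is the weight. *)
Lemma size_norm_wexact (r0 r1 : {poly K}) w : size (r0 ^+ 2 - f * r1 ^+ 2) = w.+1 ->
  wexact (r0^:P + r1^:P * 'Y) w.
Proof.
have [z0 z0E] : exists z, size r0 = z by exists (size r0).
have [z1 z1E] : exists z, size r1 = z by exists (size r1).
have s0 := size_sqr z0E.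
have p1 : r1 != 0 -> (0 < z1)%N by rewrite -z1E size_poly_gt0.
have s1 n1 := @size_cubic_sqr r1 z1 n1 z1E.
have lead0 (r : {poly K}) k : size r = k.+1 -> r`_k != 0.
  by move=> e; rewrite -[k]/(k.+1.-1) -e -lead_coefE lead_coef_eq0 -size_poly_gt0 e.
have lt (r : {poly K}) k z : size r = z -> r`_k != 0 -> (k < z)%N.
  by move=> <- n0; rewrite ltnNge; apply: contra n0 => h; rewrite nth_default.
(* Sizes exceed degrees by one: the bounds say 2 deg r0 <= w and 2 deg r1 + 3 <= w, with equality in
   one of them. *)
suff H : (size (r0 ^+ 2 - f * r1 ^+ 2) = w.+1 ->
    [/\ (2 * z0 <= w + 2)%N, r1 != 0 -> (2 * z1 + 1 <= w)%N
     & (2 * z0 = w + 2)%N \/ (r1 != 0 /\ (2 * z1 + 1 = w)%N)]).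
  move=> /H[le0 le1 e]; split=> [i j|]; first rewrite coef_linearY.
    case: j => [|[|j]] /= n0; last by rewrite eqxx in n0.
      by have := lt _ _ _ z0E n0; lia.
    have n1 : r1 != 0 by apply: contraNneq n0 => ->; rewrite coef0.
    by have := lt _ _ _ z1E n0; have := le1 n1; lia.
  case: e => [e|[n1 e]].
    exists z0.-1, 0%N; rewrite coef_linearY /=.
    by split; [apply: lead0; rewrite z0E|]; lia.
  have {}p1 := p1 n1; exists z1.-1, 1%N; rewrite coef_linearY /=.
  by split; [apply: lead0; rewrite z1E|]; lia.
have [r10|n1] := eqVneq r1 0.
  by rewrite r10 expr0n mulr0 subr0 s0 => e; split=> //; [lia|left; lia].
have e1 := s1 n1; have {}p1 := p1 n1.
have [lt01|le10] := ltnP (size (r0 ^+ 2)) (size (f * r1 ^+ 2)).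
  rewrite addrC size_polyDl ?size_polyN // e1 => e.
  by rewrite s0 e1 in lt01; split=> [|_|]; [lia|lia|right; split=> //; lia].
rewrite size_polyDl ?size_polyN; last first.
  by rewrite ltn_neqAle le10 andbT s0 e1; apply/eqP; lia.
rewrite s0 e1 in le10 *; move=> e.
by split=> [|_|]; [lia|lia|left; lia].
Qed.

(** * Reduction modulo y^2 - f without raising the weight *)

Definition reduces (S : {poly {poly K}} -> Prop) m g :=
  exists q h, [/\ g = q * W + h, S h & wlt h m].

(** The two shapes of remainder: degree at most 1 in y here, degree at most 2 in x for [small2]. *)
Definition small1 h := forall i, (size (h`_i)%R <= 2)%N.
Definition small2 h := (size h <= 3)%N.

Lemma reducesD S m g h : (forall u v, S u -> S v -> S (u + v)) ->
  reduces S m g -> reduces S m h -> reduces S m (g + h).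
Proof.
move=> SD [q [r [-> Sr wr]]] [q' [r' [-> Sr' wr']]].
exists (q + q'), (r + r'); split; [by ring|exact: SD|exact: wltD].
Qed.

Lemma reducesZ S m x g : (forall u, S u -> S (x%:P%:P * u)) ->
  reduces S m g -> reduces S m (x%:P%:P * g).
Proof.
move=> SZ [q [r [-> Sr wr]]].
exists (x%:P%:P * q), (x%:P%:P * r); split; [by ring|exact: SZ|exact: wltZ].
Qed.

Lemma reduces_all S m : S 0 -> (forall u v, S u -> S v -> S (u + v)) ->
  (forall x u, S u -> S (x%:P%:P * u)) ->
  (forall i j, (2 * i + 3 * j < m)%N -> reduces S m ('X ^+ i * 'Y ^+ j)) ->
  forall g, wlt g m -> reduces S m g.
Proof.
move=> S0 SD SZ SX g wg; have r0 : reduces S m 0.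
  by exists 0, 0; rewrite mul0r addr0; split=> //; exact: wlt0.
rewrite [g]poly2E; elim/big_ind: _ => // [x y|i _]; first exact: reducesD.
elim/big_ind: _ => // [x y|j _]; first exact: reducesD.
have [->|n0] := eqVneq (g`_i`_j) 0; first by rewrite polyC0 ?polyC0 mul0r.
by apply: reducesZ; [exact: SZ|exact: SX (wg _ _ n0)].
Qed.

Lemma reduces_cong S m g h q : g = q * W + h -> reduces S m h -> reduces S m g.
Proof.
by move=> -> [q' [r [-> Sr wr]]]; exists (q + q'), r; split=> //; ring.
Qed.

Lemma small1D u v : small1 u -> small1 v -> small1 (u + v).
Proof.
by move=> su sv i; rewrite coefD (leq_trans (size_polyD _ _)) // geq_max su sv.
Qed.

Lemma small1Z x u : small1 u -> small1 (x%:P%:P * u).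
Proof.
by move=> su i; rewrite coefCM mul_polyC (leq_trans (size_scale_leq _ _)).
Qed.

Lemma small2D u v : small2 u -> small2 v -> small2 (u + v).
Proof.
by rewrite /small2 => su sv; rewrite (leq_trans (size_polyD _ _)) // geq_max su sv.
Qed.

Lemma small2Z x u : small2 u -> small2 (x%:P%:P * u).
Proof.
by rewrite /small2 => su; rewrite mul_polyC (leq_trans (size_scale_leq _ _)).
Qed.

(** Replacing y^2 by f lowers the exponent of y by 2 and creates monomials whose weight is at most
    the old one. *)
Lemma reduces1_monomial m i j : (2 * i + 3 * j < m)%N ->
  reduces small1 m ('X ^+ i * 'Y ^+ j).
Proof.
have [k] := ubnP j; elim: k i j => // k IH i j; rewrite ltnS => le_jk lt.
have [lt2|ge2] := ltnP j 2.
  exists 0, ('X ^+ i * 'Y ^+ j); rewrite mul0r add0r; split=> //; last exact: wlt_monomial.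
  move=> l; rewrite -rmorphXn /= coefMC coefXn; case: eqP => _; last by rewrite mul0r size_poly0.
  by rewrite mul1r size_polyXn.
case: j ge2 le_jk lt => [|[|j]] // _ le_jk lt.
apply: (@reduces_cong _ _ _ ('X ^+ i.+3 * 'Y ^+ j + (a%:P%:P * ('X ^+ i.+2 * 'Y ^+ j)
   + (b%:P%:P * ('X ^+ i.+1 * 'Y ^+ j) + c%:P%:P * ('X ^+ i * 'Y ^+ j)))) ('X ^+ i * 'Y ^+ j)).
  by rewrite weierstrassE !exprS; ring.
by do ![apply: reducesD; first exact: small1D]; last apply: reducesZ;
  try exact: small1Z; try apply: reducesZ; try exact: small1Z; apply: IH; lia.
Qed.

(** Replacing x^3 by y^2 - a x^2 - b x - c lowers the exponent of x and again never raises the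
    weight. *)
Lemma reduces2_monomial m i j : (2 * i + 3 * j < m)%N ->
  reduces small2 m ('X ^+ i * 'Y ^+ j).
Proof.
have [k] := ubnP i; elim: k i j => // k IH i j; rewrite ltnS => le_ik lt.
have [lt3|ge3] := ltnP i 3.
  exists 0, ('X ^+ i * 'Y ^+ j); rewrite mul0r add0r; split=> //; last exact: wlt_monomial.
  rewrite /small2 mulrC -rmorphXn /= mul_polyC (leq_trans (size_scale_leq _ _)) //.
  by rewrite size_polyXn.
case: i ge3 le_ik lt => [|[|[|i]]] // _ le_ik lt.
apply: (@reduces_cong _ _ _ ('X ^+ i * 'Y ^+ j.+2 + ((- a)%:P%:P * ('X ^+ i.+2 * 'Y ^+ j)
   + ((- b)%:P%:P * ('X ^+ i.+1 * 'Y ^+ j) + (- c)%:P%:P * ('X ^+ i * 'Y ^+ j))))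
   (- ('X ^+ i * 'Y ^+ j))).
  by rewrite weierstrassE !exprS !polyCN; ring.
by do ![apply: reducesD; first exact: small2D]; last apply: reducesZ;
  try exact: small2Z; try apply: reducesZ; try exact: small2Z; apply: IH; lia.
Qed.

Lemma NF1_unique h q : small1 h -> NF1 a b c (q * W + h) = h.
Proof.
move=> sh; apply: (can_inj (@swapXYK _)); rewrite /NF1 swapXYK rmorphD rmorphM /=.
rewrite rmodp_addl_mul_small ?monic_swap_weierstrass //.
rewrite size_swap_weierstrass ltnS -sizeYE.
by apply/bigmax_leqP => i _; exact: sh.
Qed.

Lemma NF2_unique h q : small2 h -> NF2 a b c (q * W + h) = h.
Proof.
move=> sh; rewrite /NF2 -[q * _]mulrNN rmodp_addl_mul_small ?monic_opp_weierstrass //.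
by rewrite size_opp_weierstrass ltnS.
Qed.

Lemma wlt_NF1 g m : wlt g m -> wlt (NF1 a b c g) m.
Proof.
have s0 : small1 0 by move=> i; rewrite coef0 size_poly0.
move=> /(reduces_all s0 small1D small1Z (@reduces1_monomial m)) [q [h [-> sh wh]]].
by rewrite NF1_unique.
Qed.

Lemma wlt_NF2 g m : wlt g m -> wlt (NF2 a b c g) m.
Proof.
have s0 : small2 0 by rewrite /small2 size_poly0.
move=> /(reduces_all s0 small2D small2Z (@reduces2_monomial m)) [q [h [-> sh wh]]].
by rewrite NF2_unique.
Qed.

Lemma NF1_linear (r0 r1 : {poly K}) q :
  NF1 a b c (q * W + (r0^:P + r1^:P * 'Y)) = r0^:P + r1^:P * 'Y.
Proof. by apply/NF1P; exists q. Qed.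

Lemma NF2_cong g : exists q, NF2 a b c g = g + q * W.
Proof.
have [s0 [s1 [s2 E]]] := NF2_form a b c g.
have /NF2P[q gE] := E; exists (- q); rewrite E {1}gE; ring.
Qed.

Lemma NF1_cong g : exists q, NF1 a b c g = g + q * W.
Proof.
have [r0 [r1 E]] := NF1_form a b c g.
have /NF1P[q gE] := E; exists (- q); rewrite E {1}gE; ring.
Qed.

Lemma size_NF2 g : (size (NF2 a b c g) <= 3)%N.
Proof.
rewrite -ltnS -(size_opp_weierstrass a b c) ltn_rmodp.
by rewrite -size_poly_eq0 size_opp_weierstrass.
Qed.

End Norm.

(** * Orders on the cubic *)

Section Contact.
Variable K : fieldType.
Implicit Types (g q h : {poly {poly K}}).
Variables a b c : K.
Hypothesis n2 : 2 != 0 :> K.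
Hypothesis smooth : smooth_curve (cubic_form a b c).
Local Notation W := (weierstrass a b c).
Local Notation f := (cubic_poly a b c).
Local Notation O := (O_pt a b c).
Local Notation FO := (O_cubic a b c).
Implicit Types (P Q : cubic_pt a b c).

Lemma affine_param_on x y : y ^+ 2 = f.[x] -> local_param (x, y) W (affine_param (x, y)).
Proof. by move=> e; apply: affine_local_param => // /(smooth_simple_root smooth). Qed.

Lemma on_cubicP Q x y : pt_val Q = Some (x, y) -> y ^+ 2 = f.[x].
Proof. by case: Q => [q qP] /= qE; move: qP; rewrite qE => /eqP. Qed.

Definition val_aff x y g k := val_at (x, y) W (affine_param (x, y)) g k.

Lemma val_at_param (p : K * K) F t : val_at p F t t 1.
Proof.
by exists 1, 1, 0; rewrite !hornerC oner_neq0 expr1 mul0r addr0.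
Qed.

(** Since 0 = 0 [t], an order of 0 would have to equal its own successor. *)
Lemma val_at_zero (p : K * K) F t k : local_param p F t -> ~ val_at p F t 0 k.
Proof.
move=> tP h; have := val_atM h (val_at_param p F t); rewrite mul0r.
by move=> /(val_at_uniq tP h) /eqP; rewrite -[X in X == _]addn0 eqn_add2l.
Qed.

Lemma val_atS_ev (p : K * K) F t g k : local_param p F t -> val_at p F t g k -> (0 < k)%N ->
  g.[p.1, p.2] = 0.
Proof.
move=> tP h k0; apply/eqP; apply: contraT => /(val_at0 F t) h0.
by rewrite (val_at_uniq tP h h0) in k0.
Qed.

Lemma principal_val Q x y g (D : {freeg cubic_pt a b c}) : pt_val Q = Some (x, y) ->
  principal_divisor g D -> exists2 k, val_aff x y g k & coeff Q D = k%:Z.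
Proof.
move=> qE /(_ Q)[k [l [ok ol ->]]]; have tP := affine_param_on (on_cubicP qE).
move: ok ol; rewrite (chart_affine_cubic qE) (chart_affine_homogenize g qE).
rewrite (chart_affine_Zn _ qE) /chart_pt qE => /(ord_at_val tP) vk /(ord_at_val tP) vl.
exists k => //; have : val_at (x, y) W (affine_param (x, y)) 1 0.
  by apply: val_at0; rewrite !hornerC oner_neq0.
by move=> /(val_at_uniq tP vl) ->; rewrite subr0.
Qed.

(** At O the homogenization of degree r has order 3r minus the weight, and Z^r has order 3r. The
    coefficient at O is thus minus the weight, that is, minus the degree of the norm. *)
Lemma principal_size_norm (r0 r1 : {poly K}) (D : {freeg cubic_pt a b c}) w :
  principal_divisor (r0^:P + r1^:P * 'Y) D -> coeff O D = - w%:Z ->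
  size (r0 ^+ 2 - f * r1 ^+ 2) = w.+1.
Proof.
move=> /(_ O)[k [l [ok ol ->]]] kl; have tP := O_local_param a b c.
move: ok ol; rewrite chart_O_cubic chart_O_Zn /chart_pt /=.
move=> /(ord_at_val tP) vk /(ord_at_val tP) vl.
have vY : val_at (0, 0) FO ('X - 0%:P%:P) 'Y 3.
  exists 1, (O_unit a b c), 1; rewrite /= ev_O_unit !hornerC oner_neq0; split=> //.
  by rewrite !polyC0 subr0 mulrC O_cubicE !mul1r.
have lE := val_at_uniq tP vl (val_atX _ vY).
case E : (size (r0 ^+ 2 - f * r1 ^+ 2)) => [|w'].
  move/eqP: E; rewrite size_poly_eq0 => /eqP /norm_eq0[r00 r10].
  case: (val_at_zero tP (k := k)); move: vk.
  by rewrite r00 r10 !map_poly0 mul0r addr0 chart_O_homogenize size_poly0 big_ord0.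
have [lew vO] := O_val_homogenize a b c (size_norm_wexact E).
have kE := val_at_uniq tP vk vO.
by clear -lE kE lew kl; congr _.+1; lia.
Qed.

(** The vertical line meets the affine curve in the two points above [xd]. If [yd] = 0 these
    coincide, both summands count, and the order is 2 because [cubic_quot] times (x - xd) equals y^2
    on the curve. *)
Lemma val_vertical xd yd x y : yd ^+ 2 = f.[xd] -> y ^+ 2 = f.[x] ->
  val_aff x y ('X - xd%:P%:P) (((x, y) == (xd, yd)) + ((x, y) == (xd, - yd))).
Proof.
move=> ed e; have [exd|nx] := eqVneq x xd; last first.
  rewrite !xpair_eqE (negPf nx) /=; apply: val_at0.
  by rewrite hornerD hornerN hornerX !hornerC /= -polyCB hornerC subr_eq0.
rewrite !xpair_eqE -exd eqxx /=.
have : (y == yd) || (y == - yd) by rewrite -eqf_sqr e ed exd.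
have opp_eq z : (z == - z) = (z == 0 :> K).
  by rewrite -addr_eq0 -mulr2n -mulr_natl mulf_eq0 (negPf n2).
rewrite /val_aff; have [y0|ny] := eqVneq y 0.
  rewrite y0 eq_sym [0 == - _]eq_sym oppr_eq0 orbb => /eqP ->.
  rewrite eqxx /=; exists 1, (cubic_quot a b x)^:P, (- 1).
  rewrite ev_map_polyC (horner_cubic_quot a b c) !hornerC oner_neq0; split=> //.
    by apply: smooth_simple_root => //; rewrite -e y0 expr0n.
  rewrite (weierstrass_at a b c x) -e y0 /affine_param /= eqxx !polyC0 expr0n /= !polyC0; ring.
have -> : affine_param (x, y) = 'X - x%:P%:P by rewrite /affine_param /= (negPf ny).
have yn : (y == - y) = false by rewrite opp_eq (negPf ny).
case/orP => /eqP yE; [rewrite -yE|have -> : yd = - y by rewrite yE opprK].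
  by rewrite eqxx yn; exact: val_at_param.
by rewrite opprK yn eqxx; exact: val_at_param.
Qed.

(** Each factor is split off by showing that r0 and r1 both vanish at [x]. For y nonzero this
    follows from the vanishing at (x, y) and (x, -y); for y = 0 the points coincide and order at
    least 2 is required, whence the bound [2 * n]. *)
Lemma vertical_divides x y : y ^+ 2 = f.[x] -> forall n k k' (r0 r1 : {poly K}),
  val_aff x y (r0^:P + r1^:P * 'Y) k -> val_aff x (- y) (r0^:P + r1^:P * 'Y) k' ->
  (n <= k)%N -> (n <= k')%N -> (y = 0 -> (2 * n <= k)%N /\ (2 * n <= k')%N) ->
  exists s0 s1, r0^:P + r1^:P * 'Y = (s0^:P + s1^:P * 'Y) * ('X - x%:P%:P) ^+ n.
Proof.
move=> e; have e' : (- y) ^+ 2 = f.[x] by rewrite sqrrN.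
have tP := affine_param_on e; have tP' := affine_param_on e'.
elim=> [|n IH] k k' r0 r1 v v' lk lk' l2; first by exists r0, r1; rewrite expr0 mulr1.
have ev_lin (z : K) : (r0^:P + r1^:P * 'Y).[x, z] = r0.[x] + r1.[x] * z.
  by rewrite (evD (x, z)) (evM (x, z)) !ev_map_polyC hornerC hornerX.
have := val_atS_ev tP v (leq_trans _ lk); rewrite /= ev_lin => /(_ isT) z1.
have := val_atS_ev tP' v' (leq_trans _ lk'); rewrite /= ev_lin => /(_ isT) z2.
have [r00 r10] : r0.[x] = 0 /\ r1.[x] = 0.
  have [y0|ny] := eqVneq y 0; last first.
    have : 2 * r0.[x] = 0.
      transitivity (r0.[x] + r1.[x] * y + (r0.[x] + r1.[x] * - y)); first by ring.
      by rewrite z1 z2 addr0.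
    move/eqP; rewrite mulf_eq0 (negPf n2) => /eqP r00; split=> //.
    by move/eqP: z1; rewrite r00 add0r mulf_eq0 (negPf ny) orbF => /eqP.
  have r00 : r0.[x] = 0 by move: z1; rewrite y0 mulr0 addr0.
  split=> //; apply/eqP; apply: contraT => nr1.
  have /factor_theorem[s sE] : root r0 x by apply/eqP.
  have fx : f.[x] = 0 by rewrite -e y0 expr0n.
  have nq : (cubic_quot a b x).[x] != 0.
    by rewrite (horner_cubic_quot a b c); exact: smooth_simple_root.
  (* With r0 = s (x - x0) and y = 0 at the point, [cubic_quot] times r0 + r1 y equals y (y s +
     [cubic_quot] r1) on the curve. If r1 does not vanish there, the order is exactly 1, a
     contradiction. *)
  have v1 : val_aff x y (r0^:P + r1^:P * 'Y) 1.
    exists ('Y * s^:P + (cubic_quot a b x)^:P * r1^:P), (cubic_quot a b x)^:P, (- s^:P).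
    rewrite (evD (x, y)) !(evM (x, y)) !ev_map_polyC hornerC hornerX y0 mul0r add0r.
    split=> //=; first by rewrite mulf_neq0.
    rewrite (weierstrass_at a b c x) fx /affine_param /= eqxx sE rmorphM rmorphB /=.
    by rewrite map_polyX map_polyC /= !polyC0; ring.
  by have := val_at_uniq tP v v1; have := l2 y0; lia.
have /factor_theorem[s0 s0E] : root r0 x by apply/eqP.
have /factor_theorem[s1 s1E] : root r1 x by apply/eqP.
have gE : r0^:P + r1^:P * 'Y = (s0^:P + s1^:P * 'Y) * ('X - x%:P%:P).
  by rewrite s0E s1E !rmorphM rmorphB /= map_polyX map_polyC /=; ring.
have vx := val_vertical e e; have vx' := val_vertical e e'.
move: v v'; rewrite gE => v v'.
have [_ u] := val_at_cancel tP v vx; have [_ u'] := val_at_cancel tP' v' vx'.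
have yy : (y == - y) = (y == 0).
  by rewrite -addr_eq0 -mulr2n -mulr_natl mulf_eq0 (negPf n2).
have [||| t0 [t1 tE]] := IH _ _ _ _ u u'.
- rewrite !xpair_eqE !eqxx yy /=; case: eqVneq l2 => [y0 /(_ y0)|] /=; lia.
- rewrite !xpair_eqE !eqxx [- y == y]eq_sym yy /=; case: eqVneq l2 => [y0 /(_ y0)|] /=; lia.
- move=> y0; rewrite !xpair_eqE !eqxx y0 oppr0 !eqxx /=; have := l2 y0; lia.
by exists t0, t1; rewrite tE exprSr mulrA.
Qed.

End Contact.

(** * The contact curve *)

Section Main.
Variable K : fieldType.
Implicit Types (g q h : {poly {poly K}}).

Lemma sum_at_O g r : \sum_(i < size g) \sum_(j < size g`_i)
    g`_i`_j * (0 ^+ i * 0 ^+ (r - (i + j))) = \sum_(j < size g`_0) g`_0`_j * 0 ^+ (r - j) :> K.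
Proof.
have [->|n0] := eqVneq g 0.
  by rewrite coef0 !size_poly0 !big_ord0.
have lt0 : (0 < size g)%N by rewrite size_poly_gt0.
rewrite (bigD1 (Ordinal lt0)) //= [X in _ + X]big1 ?addr0.
  by apply: eq_bigr => j _; rewrite expr0 mul1r add0n.
by move=> [[|i] lti] //= _; apply: big1 => j _; rewrite expr0n mul0r mulr0.
Qed.

(** As [0 ^+ 0] is 1, only the term of top degree survives: the curve avoids O exactly when the
    coefficient of y^r is nonzero. *)
Lemma sum_at_O_total_degree g :
  \sum_(j < size g`_0) g`_0`_j * 0 ^+ (total_degree g - j) = g`_0`_(total_degree g).
Proof.
have le j : g`_0`_j != 0 -> (j <= total_degree g)%N by move=> /total_degree_ge.
have z j : (j == total_degree g) = false -> g`_0`_j * 0 ^+ (total_degree g - j) = 0.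
  move=> nj; have [->|n0] := eqVneq g`_0`_j 0; first by rewrite mul0r.
  have lj : (j < total_degree g)%N by rewrite ltn_neqAle nj le.
  by rewrite -(subnSK lj) expr0n mulr0.
have [lt|ge] := ltnP (total_degree g) (size g`_0).
  rewrite (bigD1 (Ordinal lt)) //= subnn mulr1 big1 ?addr0 // => j nj.
  by apply: z; apply/negbTE.
rewrite [RHS]nth_default // big1 // => j _; apply: z.
by apply/negbTE; rewrite neq_ltn (leq_trans (ltn_ord j) ge).
Qed.

Lemma homogenize_at_O g :
  (homogenize g).@[tnth [tuple 0; 1; 0]] = g`_0`_(total_degree g).
Proof.
rewrite -sum_at_O_total_degree -sum_at_O /homogenize raddf_sum /=.
apply: eq_bigr => i _; rewrite raddf_sum /=; apply: eq_bigr => j _.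
by rewrite mevalZ !mevalM !rmorphXn /= !mevalXU !(tnth_nth 0) /= expr1n mulr1.
Qed.

Lemma chart_O_at_O (a b c : K) g :
  (chart (O_pt a b c) (homogenize g)).[0, 0] = g`_0`_(total_degree g).
Proof.
rewrite -sum_at_O_total_degree -sum_at_O chart_O_homogenize.
rewrite !horner_sum; apply: eq_bigr => i _; rewrite !horner_sum; apply: eq_bigr => j _.
by rewrite !(evM (0, 0)) !(evXn (0, 0)) (evC (0, 0)) hornerX !hornerC hornerX.
Qed.

Lemma homogenize_dhomog g : homogenize g \is (total_degree g).-homog.
Proof.
apply: rpred_sum => i _; apply: rpred_sum => j _.
have [->|n0] := eqVneq g`_i`_j 0; first by rewrite scale0r rpred0.
have hX (k : 'I_3) e : ('X_k ^+ e : {mpoly K[3]}) \is e.-homog.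
  by rewrite -[X in X.-homog]mul1n; apply: dhomogMn; rewrite dhomogX; apply/eqP; exact: mdeg1.
apply: dhomogZ; rewrite -[X in _ \is X.-homog](subnKC (total_degree_ge n0)).
by apply: dhomogM; first apply: dhomogM; exact: hX.
Qed.

(** For i < 3, 2i + 3j = 3k forces i = 0 and j = k, while 2i + 3j <= 3k already gives i + j <= k. *)
Lemma NF2_total_degree h k : (size h <= 3)%N -> wexact h (3 * k) ->
  total_degree h = k /\ h`_0`_k != 0.
Proof.
move=> sh [wh [i [j [n0 e]]]].
have lt3 i' j' : h`_i'`_j' != 0 -> (i' < 3)%N.
  by move=> /coef_neq0_size[lt _]; exact: leq_trans lt sh.
have [i0 jk] : i = 0%N /\ j = k by have := lt3 _ _ n0; lia.
rewrite i0 jk in n0; split=> //; apply/eqP; rewrite eqn_leq (total_degree_ge n0) andbT.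
by apply: total_degree_le => i' j' n0'; have := lt3 _ _ n0'; have := wh _ _ n0'; lia.
Qed.

Variables a b c : K.
Hypothesis n2 : 2 != 0 :> K.
Hypothesis smooth : smooth_curve (cubic_form a b c).
Local Notation W := (weierstrass a b c).
Local Notation f := (cubic_poly a b c).
Local Notation O := (O_pt a b c).
Implicit Types (Q : cubic_pt a b c).

Lemma val_at_restricts h (D : {freeg cubic_pt a b c}) :
  h`_0`_(total_degree h) != 0 -> coeff O D = 0 ->
  (forall Q x y, pt_val Q = Some (x, y) -> exists2 k, val_aff a b c x y h k & coeff Q D = k%:Z) ->
  restricts_to (homogenize h) D.
Proof.
move=> hO DO H Q; case E: (pt_val Q) => [[x y]|]; last first.
  have -> : Q = O by apply: val_inj; rewrite /= E.
  exists 0%N; split=> //; rewrite chart_O_cubic /chart_pt /=.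
  apply: (val_at_intersection (O_local_param a b c)).
  by apply: val_at0; rewrite chart_O_at_O.
have [k v kE] := H _ _ _ E; exists k; split=> //.
rewrite (chart_affine_cubic E) (chart_affine_homogenize h E) /chart_pt E.
exact: (val_at_intersection (affine_param_on n2 smooth (on_cubicP E)) v).
Qed.

(** The base is any field in which 2 is nonzero. The equation for [g] certifies that [rdivp] returns
    an exact quotient. *)
Lemma contact_curve_of_divisors (d n : nat)
  (d_ge1 : (1 <= d)%N) (n_ge2 : (2 <= n)%N) (nd3 : (3 %| n * d)%N)
  (P : 'I_d -> cubic_pt a b c) (P_affine : forall i, P i <> O)
  (Pd : cubic_pt a b c)
  (xd yd : K) (Pd_coord : pt_val Pd = Some (xd, yd))
  (b0 b1 xi0 xi1 : {poly K})
  (b_div : principal_divisor (b0^:P + b1^:P * 'Y)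
    (\sum_(i < d) << P i >> + << iota_pt Pd >> - << O >> *+ d.+1))
  (xi_div : principal_divisor (xi0^:P + xi1^:P * 'Y)
    (<< Pd >> *+ n - << O >> *+ n)) :
  let bd := b0^:P + b1^:P * 'Y in
  let xi := xi0^:P + xi1^:P * 'Y in
  let g := NF1 a b c (bd ^+ n * xi) in
  let bnd := Pdiv.Ring.rdivp g (('X - xd%:P%:P) ^+ n) in
  let h := NF2 a b c bnd in
  g = bnd * ('X - xd%:P%:P) ^+ n /\
  [/\ plane_curve (n * d %/ 3) (homogenize h),
      (homogenize h).@[tnth [tuple 0; 1; 0]] != 0,
      restricts_to (homogenize h) ((\sum_(i < d) << P i >> : {freeg cubic_pt a b c}) *+ n)
    & n_contact a b c n (homogenize h)].
Proof.
move=> bd xi g.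
have ed : yd ^+ 2 = f.[xd] := on_cubicP Pd_coord.
have ed' : (- yd) ^+ 2 = f.[xd] by rewrite sqrrN.
have iPd_coord : pt_val (iota_pt Pd) = Some (xd, - yd) by rewrite /= Pd_coord.
have ptE Q Q' x y x' y' : pt_val Q = Some (x, y) -> pt_val Q' = Some (x', y') ->
    (Q == Q') = ((x, y) == (x', y')).
  by move=> q q'; rewrite -val_eqE /= q q'.
have ptO Q x y : pt_val Q = Some (x, y) -> (O == Q) = false.
  by move=> q; rewrite -val_eqE /= q.
(* The multiplicity of [Q] in the given effective divisor. *)
pose cnt Q := (\sum_(i < d) (P i == Q))%N.
have cntE Q : coeff Q (\sum_(i < d) << P i >>) = (cnt Q)%:Z.
  rewrite raddf_sum /= /cnt; elim/big_ind2: _ => // [x1 x2 y1 y2 -> ->|i _].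
    by rewrite PoszD.
  by rewrite coeffU mul1r; case: eqP.
have cntO : cnt O = 0%N.
  by rewrite /cnt big1 // => i _; case: eqP => // /P_affine.
have coeffb Q : coeff Q (<< iota_pt Pd >> : {freeg cubic_pt a b c}) = (iota_pt Pd == Q)%:Z.
  by rewrite coeffU mul1r; case: eqP.
have coeffPd Q : coeff Q (<< Pd >> : {freeg cubic_pt a b c}) = (Pd == Q)%:Z.
  by rewrite coeffU mul1r; case: eqP.
have coeffO Q : coeff Q (<< O >> : {freeg cubic_pt a b c}) = (O == Q)%:Z.
  by rewrite coeffU mul1r; case: eqP.
have nPO : (Pd == O) = false by rewrite -val_eqE /= Pd_coord.
have niPO : (iota_pt Pd == O) = false by rewrite -val_eqE /= Pd_coord.
have valb Q x y : pt_val Q = Some (x, y) ->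
    val_aff a b c x y bd (cnt Q + ((x, y) == (xd, - yd))).
  move=> q; have [k v] := principal_val n2 smooth q b_div.
  rewrite coeffB coeffD coeffMn cntE coeffb coeffO (ptO _ _ _ q) mul0rn subr0.
  by rewrite eq_sym (ptE _ _ _ _ _ _ q iPd_coord) -PoszD => -[->].
have valxi Q x y : pt_val Q = Some (x, y) ->
    val_aff a b c x y xi (n * ((x, y) == (xd, yd))).
  move=> q; have [k v] := principal_val n2 smooth q xi_div.
  rewrite coeffB !coeffMn coeffPd coeffO (ptO _ _ _ q) mul0rn subr0.
  by rewrite eq_sym (ptE _ _ _ _ _ _ q Pd_coord) -mulr_natr natz -PoszM mulnC => -[->].
have [q0 gE] : exists q, g = bd ^+ n * xi + q * W by exact: NF1_cong.
have [r0 [r1 g_lin]] : exists r0 r1, g = r0^:P + r1^:P * 'Y by exact: NF1_form.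
have valg Q x y : pt_val Q = Some (x, y) -> val_aff a b c x y g
    (n * (cnt Q + ((x, y) == (xd, - yd))) + n * ((x, y) == (xd, yd))).
  move=> q; apply: val_at_cong gE _; apply: val_atM; last exact: valxi q.
  by apply: val_atX; exact: valb q.
have yy : (yd == - yd) = (yd == 0).
  by rewrite -addr_eq0 -mulr2n -mulr_natl mulf_eq0 (negPf n2).
(* By [valg] the order of [g] is at least [n] at both points above [xd]; if [yd] = 0 they coincide,
   and both contributions add up to at least [2 * n]. *)
have [s0 [s1 GE]] : exists s0 s1,
    r0^:P + r1^:P * 'Y = (s0^:P + s1^:P * 'Y) * ('X - xd%:P%:P) ^+ n.
  have v := valg _ _ _ Pd_coord; have v' := valg _ _ _ iPd_coord.
  rewrite g_lin in v v'; apply: (vertical_divides n2 smooth ed v v').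
  - by rewrite eqxx muln1 leq_addl.
  - by rewrite eqxx mulnDr muln1 -addnA addnC -addnA leq_addr.
  - by move=> y0; rewrite y0 oppr0 eqxx; move: (cnt _) (cnt _) => m m'; clear; split; lia.
rewrite -g_lin in GE.
set G := s0^:P + s1^:P * 'Y in GE.
have -> /= : rdivp g (('X - xd%:P%:P) ^+ n) = G.
  by rewrite GE rdivp_mull // monic_exp // monicXsubC.
split=> //.
have arith (m i j : nat) : (n * (m + i) + n * j - n * (j + i) = n * m)%N.
  by rewrite -mulnDr -mulnBr -addnA [(i + j)%N]addnC addnK.
have valG Q x y : pt_val Q = Some (x, y) -> val_aff a b c x y G (n * cnt Q).
  move=> q; have e := on_cubicP q; have tP := affine_param_on n2 smooth e.
  have := valg _ _ _ q; rewrite GE => v.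
  have [_] := val_at_cancel tP v (val_atX n (val_vertical n2 smooth ed e)).
  by rewrite arith.
set h := NF2 a b c G.
have [q1 hE] : exists q, h = G + q * W by exact: NF2_cong.
have Gexact : wexact G (n * d).
  apply: (size_norm_wexact (a := a) (b := b) (c := c)); set N := (_ - _).
  have NbE := principal_size_norm b_div (w := d.+1).
  have NxE := principal_size_norm xi_div (w := n).
  move: NbE NxE.
  rewrite !(coeffB, coeffD, coeffMn, cntE, coeffb, coeffPd, coeffO) cntO niPO nPO eqxx.
  rewrite !add0r mul0rn add0r !natz => /(_ erefl) + /(_ erefl).
  set Nb : {poly K} := b0 ^+ 2 - _; set Nx : {poly K} := xi0 ^+ 2 - _ => NbE NxE.
  (* The norm of [g] computed from its two factorizations. Comparing degrees, n(d + 1) + n = deg N +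
     2n, so deg N = nd. *)
  have NE : Nb ^+ n * Nx = N * (('X - xd%:P) ^+ 2) ^+ n.
    apply: (is_norm_uniq (a := a) (b := b) (c := c) (g := g)).
      apply: is_norm_cong gE _; apply: is_normM; last exact: is_norm_linear.
      by apply: is_normX; exact: is_norm_linear.
    rewrite GE; apply: is_normM; first exact: is_norm_linear.
    apply: is_normX; exists 0.
    have -> : 'X - xd%:P%:P = ('X - xd%:P)^:P :> {poly {poly K}}.
      by rewrite rmorphB /= map_polyX map_polyC.
    by rewrite conjY_map_polyC mul0r addr0 rmorphXn.
  have nb0 : Nb != 0 by rewrite -size_poly_gt0 NbE.
  have nx0 : Nx != 0 by rewrite -size_poly_gt0 NxE.
  have nX0 : 'X - xd%:P != 0 :> {poly K} by rewrite polyXsubC_eq0.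
  have N0 : N != 0.
    have : Nb ^+ n * Nx != 0 by rewrite mulf_neq0 ?expf_neq0.
    by rewrite NE mulf_eq0 => /norP[].
  have := congr1 (fun p : {poly K} => (size p).-1) NE.
  rewrite !size_mul ?expf_neq0 // -exprM.
  have sX : size (('X - xd%:P) ^+ (2 * n)) = (2 * n).+1 by exact: size_exp_XsubC.
  have sb : size (Nb ^+ n) = (n * d.+1).+1.
    have : (0 < size (Nb ^+ n)%R)%N by rewrite size_poly_gt0 expf_neq0.
    have := size_exp Nb n; rewrite NbE /= mulnC => <-.
    by case: (size _).
  rewrite sX sb NxE; have : (0 < size N)%N by rewrite size_poly_gt0.
  by move: (size N) => z; clear; lia.
have [k kE] : exists k, (n * d)%N = (3 * k)%N.
  by exists (n * d %/ 3)%N; rewrite [RHS]mulnC divnK.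
(* The weight of [h] is at most that of [G]. Were it smaller, [G], which is the first normal form of
   [h], would have smaller weight too. *)
have hexact : wexact h (3 * k).
  have [wG _] := Gexact; rewrite kE in wG Gexact.
  have [w|//] := wexact_or (@wlt_NF2 K a b c _ _ wG).
  case: (wexact_not Gexact); have := @wlt_NF1 K a b c _ _ w; rewrite -/h hE.
  by rewrite addrC [NF1 _ _ _ _]NF1_linear.
have [tdE hk] := NF2_total_degree (size_NF2 a b c G) hexact.
have nd3E : (n * d %/ 3)%N = k by rewrite kE mulKn.
have hO : (homogenize h).@[tnth [tuple 0; 1; 0]] != 0 by rewrite homogenize_at_O tdE.
have curve : plane_curve (n * d %/ 3) (homogenize h).
  split; first by rewrite nd3E; nia.
    by apply: contraNneq hO => ->; rewrite meval0.
  by rewrite nd3E -{1}tdE homogenize_dhomog.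
have rest : restricts_to (homogenize h) ((\sum_(i < d) << P i >> : {freeg cubic_pt a b c}) *+ n).
  apply: val_at_restricts; first by rewrite tdE.
    by rewrite coeffMn cntE cntO mul0rn.
  move=> Q x y q; exists (n * cnt Q)%N; last by rewrite coeffMn cntE -mulr_natr natz -PoszM mulnC.
  by apply: val_at_cong hE _; exact: valG.
split=> //; split; first by exists (n * d %/ 3)%N.
by exists d, P.
Qed.

End Main.

Theorem mainTheorem2 (R : realType) (a b c : R[i])
  (E_smooth : smooth_curve (cubic_form a b c))
  (d n : nat) (d_ge1 : (1 <= d)%N) (n_ge2 : (2 <= n)%N) (nd3 : (3 %| n * d)%N)
  (P : 'I_d -> cubic_pt a b c) (P_affine : forall i, P i <> O_pt a b c)
  (Pd : cubic_pt a b c)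
  (PdE : Pd = \big[@add_pt _ a b c/O_pt a b c]_(i < d) P i)
  (xd yd : R[i]) (Pd_coord : pt_val Pd = Some (xd, yd))
  (Pd_order : has_order n Pd)
  (b0 b1 xi0 xi1 : {poly R[i]})
  (b_div : principal_divisor (b0^:P + b1^:P * 'Y)
    (\sum_(i < d) << P i >> + << iota_pt Pd >> - << O_pt a b c >> *+ d.+1))
  (xi_div : principal_divisor (xi0^:P + xi1^:P * 'Y)
    (<< Pd >> *+ n - << O_pt a b c >> *+ n)) :
  let bd := b0^:P + b1^:P * 'Y in
  let xi := xi0^:P + xi1^:P * 'Y in
  let g := NF1 a b c (bd ^+ n * xi) in
  let bnd := Pdiv.Ring.rdivp g (('X - xd%:P%:P) ^+ n) in
  let h := NF2 a b c bnd in
  g = bnd * ('X - xd%:P%:P) ^+ n /\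
  [/\ plane_curve (n * d %/ 3) (homogenize h),
      (homogenize h).@[tnth [tuple 0; 1; 0]] != 0,
      restricts_to (homogenize h) ((\sum_(i < d) << P i >> : {freeg cubic_pt a b c}) *+ n)
    & n_contact a b c n (homogenize h)].
Proof.
have n2 : 2 != 0 :> R[i] by rewrite Num.Theory.pnatr_eq0.
exact: (contact_curve_of_divisors n2 E_smooth d_ge1 n_ge2 nd3 P_affine Pd_coord
  b_div xi_div).
Qed.
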